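(* Let $X$ be a (complete) doubling metric measure space, let $1\le p<\infty$ and $\beta\ne p$, and assume that the open set $\Omega\subset X$ admits a $(p,\beta)$-Hardy inequality. Then there exists $\varepsilon>0$, depending only on $p$, $\beta$, the doubling constant of $\mu$ and the constant of the Hardy inequality, such that for each ball $B_0\subset X$ either \[\operatorname{co\,dim}_H(2B_0\cap(X\setminus\Omega))<p-\beta-\varepsilon\quad\text{or}\quad\underline{\operatorname{co\,dim}}_A(B_0\cap(X\setminus\Omega))>p-\beta+\varepsilon.\]
   Context: $(X,d,\mu)$ is a complete metric space with a Borel measure $\mu$ such that every closed ball $B(x,r)=\{y:d(x,y)\le r\}$, $r>0$, has $0<\mu(B(x,r))<\infty$, and $\mu$ is doubling. For a ball $B=B(x,r)$, $2B=B(x,2r)$. A Borel function $g\ge 0$ is an upper gradient of $f$ if $|f(x)-f(y)|\le\int_\gamma g\,ds$ for every compact rectifiable curve $\gamma$ with endpoints $x,y$. For open $\Omega\subset X$, $d_\Omega(x)=\operatorname{dist}(x,X\setminus\Omega)$; $\Omega$ admits a $(p,\beta)$-Hardy inequality if there is $C>0$ with $\int_\Omega|u|^p d_\Omega^{\beta-p}\,d\mu\le C\int_\Omega g_u^p d_\Omega^{\beta}\,d\mu$ for all Lipschitz $u$ with compact support in $\Omega$ and all upper gradients $g_u$ of $u$. For $E\subset X$: $E_r=\{x:\operatorname{dist}(x,E)<r\}$; $\underline{\operatorname{co\,dim}}_A(E)$ is the supremum of all $t\ge0$ for which there is $C\ge1$ with $\frac{\mu(E_r\cap B(x,R))}{\mu(B(x,R))}\le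 C(r/R)^t$ for all $x\in E$, $0<r<R<\operatorname{diam}(E)$. The Hausdorff content of codimension $q$ is $\mathcal H_R^{\mu,q}(A)=\inf\{\sum_k\operatorname{rad}(B_k)^{-q}\mu(B_k): A\subset\bigcup_k B_k,\ \operatorname{rad}(B_k)\le R\}$, and the Hausdorff codimension is $\operatorname{co\,dim}_H(E)=\sup\{q\ge0:\mathcal H_R^{\mu,q}(E)=0\}$ (independent of $R>0$), with $\operatorname{co\,dim}_H(E)=0$ if $\mu(E)>0$. *)

(* Defs.v *)
From HB Require Import structures.
From mathcomp Require Import all_boot all_order all_algebra.
From mathcomp Require Import all_classical all_reals all_analysis.
Set Implicit Arguments. Unset Strict Implicit. Unset Printing Implicit Defensive.
Import Order.TTheory GRing.Theory Num.Theory.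
From mathcomp Require Import measurable_realfun.
Import numFieldNormedType.Exports.
Local Open Scope classical_set_scope.
Local Open Scope ring_scope.

Definition is_metric (R : realType) (X : Type) (d : X -> X -> R) : Prop :=
  (forall x y, 0 <= d x y) /\ (forall x y, d x y = 0 <-> x = y) /\
  (forall x y, d x y = d y x) /\ (forall x y z, d x z <= d x y + d y z).

Definition cball (R : realType) (X : Type) (d : X -> X -> R) (x : X) (r : R)
  : set X := [set y | d x y <= r].

Definition dopen (R : realType) (X : Type) (d : X -> X -> R) (U : set X) : Prop :=
  forall x, U x -> exists r : R, 0 < r /\ [set y | d x y < r] `<=` U.

Definition dclosure (R : realType) (X : Type) (d : X -> X -> R) (A : set X)
  : set X := [set x | forall e : R, 0 < e -> exists2 y, A y & d x y < e].

Definition dcompact (R : realType) (X : Type) (d : X -> X -> R) (K : set X)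
  : Prop :=
  forall (I : Type) (U : I -> set X), (forall i, dopen d (U i)) ->
    K `<=` \bigcup_i U i ->
    exists (n : nat) (f : nat -> I), K `<=` \bigcup_(k in [set k | (k < n)%N]) U (f k).

Definition dcomplete (R : realType) (X : Type) (d : X -> X -> R) : Prop :=
  forall u : nat -> X,
    (forall e : R, 0 < e -> exists N, forall m n, (N <= m)%N -> (N <= n)%N ->
        d (u m) (u n) < e) ->
    exists l, forall e : R, 0 < e -> exists N, forall n, (N <= n)%N -> d (u n) l < e.

(** dist(x,A) = inf_{y in A} d(x,y)  (= +oo if A is empty) *)
Definition edist (R : realType) (X : Type) (d : X -> X -> R) (x : X) (A : set X)
  : \bar R := ereal_inf [set (d x y)%:E | y in A].

Definition ediam (R : realType) (X : Type) (d : X -> X -> R) (E : set X)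
  : \bar R := ereal_sup [set v | exists x y, E x /\ E y /\ v = (d x y)%:E].

Definition nbhd_set (R : realType) (X : Type) (d : X -> X -> R) (E : set X)
  (r : R) : set X := [set x | (edist d x E < r%:E)%E].

Definition dist_compl (R : realType) (X : Type) (d : X -> X -> R) (O : set X)
  (x : X) : \bar R := edist d x (~` O).

Definition borel_sigma (R : realType) (dX : measure_display)
  (X : measurableType dX) (d : X -> X -> R) : Prop :=
  forall A : set X, measurable A <-> <<s [set U | dopen d U] >> A.

Definition balls_pos_finite (R : realType) (dX : measure_display)
  (X : measurableType dX) (d : X -> X -> R) (mu : {measure set X -> \bar R})
  : Prop :=
  forall x (r : R), 0 < r -> (0 < mu (cball d x r))%E /\ (mu (cball d x r) < +oo)%E.

Definition doubling_with (R : realType) (dX : measure_display)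
  (X : measurableType dX) (d : X -> X -> R) (mu : {measure set X -> \bar R})
  (Cd : R) : Prop :=
  forall x (r : R), 0 < r -> (mu (cball d x (2 * r)) <= Cd%:E * mu (cball d x r))%E.

Definition variation (R : realType) (X : Type) (d : X -> X -> R)
  (gamma : R -> X) (s t : R) : \bar R :=
  ereal_sup [set v | exists (n : nat) (f : nat -> R),
     f 0%N = s /\ f n = t /\ (forall i, (i < n)%N -> f i <= f i.+1) /\
     v = (\sum_(i < n) d (gamma (f i)) (gamma (f i.+1)))%:E].

Definition arclength_curve (R : realType) (X : Type) (d : X -> X -> R)
  (gamma : R -> X) (L : R) : Prop :=
  0 <= L /\ forall s t, 0 <= s -> s <= t -> t <= L -> variation d gamma s t = (t - s)%:E.

Definition line_integral (R : realType) (X : Type) (g : X -> \bar R)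
  (gamma : R -> X) (L : R) : \bar R :=
  (\int[@lebesgue_measure R]_(t in `[0%R, L]%classic) g (gamma t))%E.

Definition upper_gradient (R : realType) (dX : measure_display)
  (X : measurableType dX) (d : X -> X -> R) (f : X -> R) (g : X -> \bar R)
  : Prop :=
  measurable_fun setT g /\ (forall x, (0 <= g x)%E) /\
  forall (gamma : R -> X) (L : R), arclength_curve d gamma L ->
    (`|f (gamma 0) - f (gamma L)|%:E <= line_integral g gamma L)%E.

Definition lipschitz (R : realType) (X : Type) (d : X -> X -> R) (u : X -> R)
  : Prop := exists L : R, forall x y, `|u x - u y| <= L * d x y.

Definition compact_support_in (R : realType) (X : Type) (d : X -> X -> R)
  (u : X -> R) (O : set X) : Prop :=
  dcompact d (dclosure d [set x | u x != 0]) /\ dclosure d [set x | u x != 0] `<=` O.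

Definition hardy_ineq (R : realType) (dX : measure_display)
  (X : measurableType dX) (d : X -> X -> R) (mu : {measure set X -> \bar R})
  (O : set X) (p beta C : R) : Prop :=
  0 < C /\
  forall (u : X -> R) (g : X -> \bar R),
    lipschitz d u -> compact_support_in d u O -> upper_gradient d u g ->
    (\int[mu]_(x in O) (poweR (`|u x|%:E) p * poweR (dist_compl d O x) (beta - p))
      <= C%:E * \int[mu]_(x in O) (poweR (g x) p * poweR (dist_compl d O x) beta))%E.

Definition haus_content (R : realType) (dX : measure_display)
  (X : measurableType dX) (d : X -> X -> R) (mu : {measure set X -> \bar R})
  (q Rs : R) (A : set X) : \bar R :=
  ereal_inf [set v | exists (I : set nat) (c : nat -> X) (r : nat -> R),
     (forall k, I k -> 0 < r k /\ r k <= Rs) /\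
     A `<=` \bigcup_(k in I) cball d (c k) (r k) /\
     v = (\esum_(k in I) ((r k `^ (- q))%:E * mu (cball d (c k) (r k))))%E].

(** Hausdorff codimension (computed at scale 1; the paper notes independence
    of the scale); = 0 if mu(E) > 0 *)
Definition codim_H (R : realType) (dX : measure_display)
  (X : measurableType dX) (d : X -> X -> R) (mu : {measure set X -> \bar R})
  (E : set X) : \bar R :=
  if (0 < mu E)%E then 0%E
  else ereal_sup [set q%:E | q in [set q : R | 0 <= q /\ haus_content d mu q 1 E = 0%E]].

Definition lower_codim_A (R : realType) (dX : measure_display)
  (X : measurableType dX) (d : X -> X -> R) (mu : {measure set X -> \bar R})
  (E : set X) : \bar R :=
  ereal_sup [set t%:E | t in [set t : R | 0 <= t /\
     exists C : R, 1 <= C /\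
       forall x (r Rb : R), E x -> 0 < r -> r < Rb -> (Rb%:E < ediam d E)%E ->
         (mu (nbhd_set d E r `&` cball d x Rb) <= (C * (r / Rb) `^ t)%:E * mu (cball d x Rb))%E]].

(* Main.v *)
(** Put q = p - beta. If beta > p the exponent t = 0 already shows that the lower
Assouad codimension is nonnegative, hence larger than q + eps for small eps.

Let beta < p, and suppose that the Hausdorff codimension of F, the part of the
complement of Omega in 2B_0, is at least q - eps. Then F has zero content of some
codimension s > q - delta, where delta = a p = 2 eps, so it is covered by finitely many small
balls B_k with sum rad(B_k)^(-(q - delta)) mu(B_k) as small as we like. The Hardy
inequality is tested on v = zeta^(n+1) W(d_Omega): here zeta is a cutoff which lives near
a ball B(x, R) and vanishes on every 2B_k, and W(t) = min(t^(-a), r^(-2a) t^a)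
behaves like t^(-a) at scales above r and like t^a below r. Since |W'| <= a W / t, the
terms of the right hand side that contain the derivative of W, or the derivative of
zeta at points where d_Omega is small compared with zeta times the scale of the cutoff,
are absorbed into the left hand side if a is small. What remains is
C R^(-(q + delta)) mu(B(x, R)) from the cutoff at scale R, because W(t) <= t^(-a), and
C_r sum rad(B_k)^(-(q - delta)) mu(B_k) from the holes, because W(t) <= r^(-2a) t^a.
The second sum is negligible, and the left hand side controls
r^(-(q + delta)) mu(E_r cap B(x, R)). Hence the lower Assouad codimension is at least
q + delta. *)

Require Import Defs.
From HB Require Import structures.
From mathcomp Require Import all_boot all_order all_algebra.
From mathcomp Require Import all_classical all_reals all_analysis.
From mathcomp Require Import measurable_realfun.
Import Order.TTheory GRing.Theory Num.Theory.
Import numFieldNormedType.Exports.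
From mathcomp Require Import ring lra.
Set Implicit Arguments. Unset Strict Implicit. Unset Printing Implicit Defensive.
Local Open Scope classical_set_scope.
Local Open Scope ring_scope.

(** * Metric measure spaces and upper gradients *)

Section Metric.
Context {R : realType} {X : Type}.
Variables (d : X -> X -> R) (hd : is_metric d).

Lemma dist_ge0 x y : 0 <= d x y. Proof. by have [h _] := hd; apply: h. Qed.
Lemma distxx x : d x x = 0.
Proof. by have [_ [h _]] := hd; apply/h. Qed.
Lemma distC x y : d x y = d y x. Proof. by have [_ [_ [h _]]] := hd; apply: h. Qed.
Lemma dist_triangle y x z : d x z <= d x y + d y z.
Proof. by have [_ [_ [_ h]]] := hd; apply: h. Qed.

Lemma dist_lip z x y : `|d z x - d z y| <= d x y.
Proof.
rewrite ler_distl; apply/andP; split.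
  by rewrite lerBlDr; have := dist_triangle x z y; lra.
by have := dist_triangle y z x; rewrite (distC y x); lra.
Qed.

Lemma lip_dopen_gt (f : X -> R) (L a : R) :
  (forall x y, `|f x - f y| <= L * d x y) -> dopen d [set y | a < f y].
Proof.
move=> fL x /= ax.
have L1 : 0 < `|L| + 1 by have := normr_ge0 L; lra.
exists ((f x - a) / (`|L| + 1)); split; first by rewrite divr_gt0 // subr_gt0.
move=> y /=; rewrite ltr_pdivlMr // => h.
have := fL x y; rewrite ler_norml => /andP[_].
have := dist_ge0 x y; have := ler_norm L => h1 h2 h3.
have : L * d x y <= `|L| * d x y by rewrite ler_wpM2r.
rewrite mulrDr mulr1 (mulrC (d x y)) in h.
lra.
Qed.

Lemma dopen_ball x r : dopen d [set y | d x y < r].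
Proof.
have -> : [set y | d x y < r] = [set y | - r < - d x y].
  by apply/seteqP; split=> y /=; rewrite ltrN2.
apply: (@lip_dopen_gt _ 1) => y z.
by rewrite -opprD normrN mul1r; exact: dist_lip.
Qed.

End Metric.

Section MetricMeasure.
Context {R : realType} {dX : measure_display} {X : measurableType dX}.
Variables (d : X -> X -> R) (hd : is_metric d).
Hypothesis hB : borel_sigma d.

Lemma dopen_measurable U : dopen d U -> measurable U.
Proof. by move=> oU; apply/hB; exact: sub_sigma_algebra. Qed.

Lemma measurable_ballo x r : measurable [set y | d x y < r].
Proof. by apply: dopen_measurable; exact: dopen_ball hd _ _. Qed.

Lemma measurable_cball x r : measurable (cball d x r).
Proof.
have -> : cball d x r = ~` [set y | r < d x y].
  by apply/seteqP; split=> y; rewrite /cball /= => h; [apply/negP; rewrite -leNgt|rewrite leNgt; apply/negP].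
apply: measurableC; apply: dopen_measurable.
by apply: (@lip_dopen_gt _ _ _ hd _ 1) => y z; rewrite mul1r dist_lip.
Qed.

Lemma measurable_lip (f : X -> R) : Defs.lipschitz d f -> measurable_fun setT f.
Proof.
move=> [L fL]; apply: (measurability _ (RGenOInfty.measurableE R)) => //.
move=> /= _ [_ [a ->] <-]; rewrite preimage_itvoy setTI.
by apply: dopen_measurable; exact: lip_dopen_gt fL.
Qed.

Lemma measurable_curve (G : R -> X) :
  (forall s t, d (G s) (G t) <= `|s - t|) ->
  measurable_fun setT (G : measurableTypeR R -> X).
Proof.
move=> hG.
apply: (@measurability _ _ _ _ setT _ [set U | dopen d U]).
  by apply/seteqP; split=> U /hB.
move=> /= _ [U oU <-]; rewrite setTI.
apply: open_measurable; rewrite openE => t /= Ut.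
have [r [r0 hr]] := oU _ Ut.
apply/nbhs_ballP; exists r => //= s; rewrite /ball /= => ts.
by apply: hr => /=; apply: le_lt_trans (hG _ _) ts.
Qed.

Lemma arclength_lip (gamma : R -> X) (L : R) : arclength_curve d gamma L ->
  forall s t, 0 <= s -> s <= t -> t <= L -> d (gamma s) (gamma t) <= t - s.
Proof.
move=> [L0 h] s t s0 st tL.
rewrite -lee_fin -(h s t s0 st tL); apply: ereal_sup_ubound => /=.
exists 1%N, (fun n => if n is 0%N then s else t); split => //; split => //.
by split; [case|rewrite big_ord1].
Qed.

(* Continuous induction along the curve: on a small arc the increment of [u]
   is at most the integral of [g] over the arc plus [e] times its length. *)
Lemma upper_gradient_local (u : X -> R) (g : X -> R) :
  measurable_fun setT g -> (forall x, 0 <= g x) ->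
  (forall y e, 0 < e -> exists rho, 0 < rho /\ exists2 a, 0 <= a &
     forall z, d y z < rho -> `|u y - u z| <= (a + e) * d y z /\ a <= g z) ->
  upper_gradient d u (EFin \o g).
Proof.
move=> mg g0 hloc; split; first exact/measurable_EFinP.
split; first by move=> x; rewrite lee_fin.
move=> gamma0 L hgam0.
have L0 : 0 <= L by case: hgam0.
(* Clamping the parameter makes the curve 1-Lipschitz on the whole line, so
   that [g \o gamma] is measurable. *)
pose gamma t := gamma0 (Num.max 0 (Num.min t L)).
have clamp t : 0 <= t -> t <= L -> gamma t = gamma0 t.
  by move=> t0 tL; rewrite /gamma min_l // max_r.
have gl s t : s <= t -> d (gamma s) (gamma t) <= t - s.
  move=> st; apply: le_trans (arclength_lip hgam0 _ _ _) _.
  - by rewrite le_max lexx.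
  - by rewrite ge_max !le_max lexx /= le_min !ge_min lexx st !orbT.
  - by rewrite ge_max L0 ge_min lexx orbT.
  - apply: le_trans (_ : Num.min t L - Num.min s L <= _).
      have : Num.min s L <= Num.min t L by rewrite le_min !ge_min lexx st !orbT.
      by case: (leP 0 (Num.min s L)); case: (leP 0 (Num.min t L)); lra.
    by case: (leP s L); case: (leP t L); lra.
have hG s t : d (gamma s) (gamma t) <= `|s - t|.
  case: (leP s t) => st.
    by rewrite distrC ger0_norm ?subr_ge0 //; exact: gl.
  by rewrite ger0_norm ?subr_ge0 ?(ltW st) // (distC hd); apply: gl; exact: ltW.
have mG : measurable_fun setT (EFin \o g \o gamma : measurableTypeR R -> \bar R).
  apply: measurableT_comp; first exact/measurable_EFinP.
  exact: measurable_curve.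
rewrite -(clamp 0) // -(clamp L) //.
have -> : line_integral (EFin \o g) gamma0 L = line_integral (EFin \o g) gamma L.
  apply: eq_integral => t; rewrite inE /= in_itv /= => /andP[t0 tL].
  by rewrite clamp.
have [I IE] : exists I, forall t, I t = line_integral (EFin \o g) gamma t by eexists.
have Iadd s t a : 0 <= s -> s <= t -> 0 <= a ->
    (forall w, s < w -> w <= t -> a <= g (gamma w)) ->
    (I s + (a * (t - s))%:E <= I t)%E.
  move=> s0 st a0 ha; rewrite !IE /line_integral.
  have -> : `[0, t]%classic = `[0, s]%classic `|` `]s, t]%classic :> set R.
    apply/seteqP; split=> w /=; rewrite !in_itv /=.
      by move=> /andP[w0 wt]; case: (leP w s) => ws; [left|right]; rewrite ?w0 ?wt.
    by move=> [|] /andP[h1 h2]; apply/andP; split; lra.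
  rewrite ge0_integral_setU //=.
  - apply: leeD => //.
    have -> : (a * (t - s))%:E = (\int[@lebesgue_measure R]_(x in `]s, t]) a%:E)%E.
      rewrite integral_cst //= lebesgue_measure_itv /= lte_fin -EFinB.
      case: ltP => h; first by rewrite -EFinM.
      have -> : t - s = 0 by lra.
      by rewrite mulr0 mule0.
    apply: ge0_le_integral => //=.
    + by apply: measurable_funTS; exact: mG.
    + by move=> w; rewrite in_itv /= => /andP[h1 h2]; rewrite lee_fin ha.
  - exact: (measurable_funTS mG).
  - by move=> w _; rewrite lee_fin.
  - by apply/disj_setPS => w /= []; rewrite !in_itv /= => /andP[_ h1] /andP[h2 _]; move: h2; rewrite ltNge h1.
have I0 t : (0 <= I t)%E by rewrite IE; apply: integral_ge0 => w _; rewrite lee_fin.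
suff key e : 0 < e -> (`|u (gamma 0) - u (gamma L)|%:E <= I L + (e * L)%:E)%E.
  rewrite -IE; case: (I L) (I0 L) key => [x|_ _|//]; last by rewrite leey.
  move=> _ key; rewrite lee_fin; apply/ler_addgt0Pr => e e0.
  have L1 : 0 < L + 1 by lra.
  have := key (e / (L + 1)) (divr_gt0 e0 L1); rewrite -EFinD lee_fin => /le_trans; apply.
  rewrite lerD2l mulrAC ler_pdivrMr // ler_pM2l //; lra.
move=> e0.
pose P t := (`|u (gamma 0) - u (gamma t)|%:E <= I t + (e * t)%:E)%E.
have step s t a : 0 <= s -> s <= t -> 0 <= a -> P s ->
   (forall w, s < w -> w <= t -> a <= g (gamma w)) ->
   `|u (gamma s) - u (gamma t)| <= (a + e) * (t - s) -> P t.
  move=> s0 st a0 Ps ha hu; rewrite /P.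
  apply: le_trans (_ : ((I s + (a * (t - s))%:E) + (e * t)%:E <= _)%E); last first.
    by apply: leeD => //; apply: Iadd.
  apply: le_trans (_ : (`|u (gamma 0) - u (gamma s)|%:E + `|u (gamma s) - u (gamma t)|%:E <= _)%E).
    by rewrite -EFinD lee_fin ler_distD.
  apply: le_trans (_ : ((I s + (e * s)%:E) + ((a + e) * (t - s))%:E <= _)%E).
    by apply: leeD => //; rewrite lee_fin.
  rewrite -!addeA; apply: leeD2l; rewrite -!EFinD lee_fin; lra.
(* [S] collects the parameters at which the estimate holds. Its supremum [T] belongs to it, by the
   local bound at [gamma T] used backwards; if [T < L], the same bound used forwards would give a
   larger element. *)
pose S := [set t | 0 <= t <= L /\ P t].
have S0 : S 0.
  split; first by rewrite lexx L0.
  by rewrite /P subrr normr0 mulr0 adde0; exact: I0.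
have hS : has_sup S.
  by split; [exists 0|exists L => t [/andP[_ +] _]].
pose T := sup S.
have T0 : 0 <= T by apply: ub_le_sup => //; exact: hS.2.
have TL : T <= L by apply: ge_sup; [exists 0|move=> t [/andP[_ +] _]].
have [rho [rho0 [a a0 hrho]]] := hloc (gamma T) e e0.
have PT : P T.
  have [s [hs Ps] sT] := sup_adherent rho0 hS; rewrite -/T in sT.
  have sleT : s <= T by apply: ub_le_sup; [exact: hS.2|split].
  have s0 : 0 <= s by case/andP: hs.
  have near w : s <= w -> w <= T -> d (gamma T) (gamma w) < rho.
    by move=> sw wT; rewrite (distC hd); apply: le_lt_trans (gl _ _ wT) _; lra.
  apply: (step s T a) => //.
    by move=> w /ltW sw wT; have [] := hrho _ (near w sw wT).
  have [+ _] := hrho _ (near s (lexx _) sleT); rewrite distrC => /le_trans; apply.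
  by apply: ler_wpM2l; [lra|rewrite (distC hd); exact: gl].
suff <- : T = L by [].
apply/eqP; rewrite eq_le TL /= leNgt; apply/negP => TltL.
pose t := Num.min L (T + rho / 2).
have Tt : T < t by rewrite lt_min TltL /=; lra.
have tL : t <= L by rewrite ge_min lexx.
have tr : t <= T + rho / 2 by rewrite ge_min lexx orbT.
have near w : T <= w -> w <= t -> d (gamma T) (gamma w) < rho.
  by move=> Tw wt; apply: le_lt_trans (gl _ _ Tw) _; lra.
have : S t.
  split; first by apply/andP; split; lra.
  apply: (step T t a) => //; first exact: ltW.
    by move=> w /ltW sw wT; have [] := hrho _ (near w sw wT).
  have [+ _] := hrho _ (near t (ltW Tt) (lexx _)) => /le_trans; apply.
  by apply: ler_wpM2l; [lra|apply: gl; exact: ltW].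
by move=> /(ub_le_sup hS.2); rewrite leNgt Tt.
Qed.

End MetricMeasure.

(** * Compactness and coverings *)

Lemma natSinv_lt (R : realType) (e : R) : 0 < e ->
  exists N, forall n, (N <= n)%N -> n.+1%:R^-1 < e.
Proof.
move=> e0; exists (Num.truncn e^-1) => n Nn.
rewrite invf_plt ?posrE ?ltr0n //.
by apply: lt_le_trans (truncnS_gt _) _; rewrite ler_nat ltnS.
Qed.

Section Distance.
Context {R : realType} {X : Type}.
Variables (d : X -> X -> R) (hd : is_metric d).

(** Nonemptiness makes the infimum finite, so the distance can be handled as a real function through
    its greatest lower bound property, from which the Lipschitz bound follows. *)
Lemma edist_fun (A : set X) : A !=set0 -> exists D : X -> R,
  [/\ forall x, Defs.edist d x A = (D x)%:E, forall x, 0 <= D x,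
      forall x y, A y -> D x <= d x y,
      forall x t, (forall y, A y -> t <= d x y) -> t <= D x &
      forall x y, `|D x - D y| <= d x y].
Proof.
move=> [a Aa].
have [d0 _] := hd.
have lb x t : (forall y, A y -> t <= d x y) -> (t%:E <= Defs.edist d x A)%E.
  by move=> h; apply: le_ereal_inf_tmp => _ /= [y Ay <-]; rewrite lee_fin h.
have ub x y : A y -> (Defs.edist d x A <= (d x y)%:E)%E.
  by move=> Ay; apply: ereal_inf_lbound; exists y.
have fin x : Defs.edist d x A \is a fin_num.
  apply/fin_numPlt; apply/andP; split.
    by apply: lt_le_trans (lb x 0 (fun y _ => d0 x y)); rewrite ltNyr.
  by apply: le_lt_trans (ub x a Aa) _; rewrite ltry.
pose D x := fine (Defs.edist d x A).
have DE x : Defs.edist d x A = (D x)%:E by rewrite /D fineK.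
have hub x y : A y -> D x <= d x y by move=> Ay; rewrite -lee_fin -DE; exact: ub.
have hlb x t : (forall y, A y -> t <= d x y) -> t <= D x.
  by move=> h; rewrite -lee_fin -DE; exact: lb.
exists D; split => //; first by move=> x; apply: hlb.
have one x y : D x - d x y <= D y.
  apply: hlb => z Az; rewrite lerBlDl.
  by apply: le_trans (hub _ _ Az) (dist_triangle hd _ _ _).
move=> x y; rewrite ler_norml; have := one x y; have := one y x.
by rewrite (distC hd y x); lra.
Qed.

End Distance.

(** * Doubling measures: total boundedness, compactness, finite covers *)

Section Compactness.
Context {R : realType} {dX : measure_display} {X : measurableType dX}.
Variables (d : X -> X -> R) (mu : {measure set X -> \bar R}) (Cd : R).
Hypotheses (hd : is_metric d) (hB : borel_sigma d).
Hypotheses (hfin : balls_pos_finite d mu) (hdoub : doubling_with d mu Cd).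

Lemma cball_fineK x r : 0 < r -> mu (cball d x r) = (fine (mu (cball d x r)))%:E.
Proof.
move=> r0; have [h1 h2] := hfin x r0.
by rewrite fineK // ge0_fin_numE.
Qed.

Lemma cball_fine_gt0 x r : 0 < r -> 0 < fine (mu (cball d x r)).
Proof. by move=> r0; have [h1 h2] := hfin x r0; rewrite fine_gt0 // h1 h2. Qed.

Lemma mu_le (P Q : set X) : measurable P -> measurable Q -> P `<=` Q -> (mu P <= mu Q)%E.
Proof. by move=> mP mQ; apply: le_measure; rewrite inE. Qed.

Lemma doubling_gt0 (x : X) : 0 < Cd.
Proof.
have h1 : (0 : R) < 1 by []; have h2 : (0 : R) < 2 * 1 by [].
have := hdoub x h1; rewrite (cball_fineK _ h2) (cball_fineK _ h1) -EFinM lee_fin.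
have := cball_fine_gt0 x h2; have := cball_fine_gt0 x h1.
by move=> m1 m2 h; rewrite -(pmulr_lgt0 _ m1); apply: lt_le_trans h.
Qed.

Lemma doubling_iter (x : X) n r : 0 < r ->
  (mu (cball d x (2 ^+ n * r)) <= (Cd ^+ n)%:E * mu (cball d x r))%E.
Proof.
move=> r0; elim: n => [|n IH]; first by rewrite !expr0 mul1r mul1e.
have r1 : 0 < 2 ^+ n * r by rewrite mulr_gt0 // exprn_gt0.
rewrite exprS -mulrA; apply: le_trans (hdoub x r1) _.
rewrite exprS EFinM -muleA; apply: lee_wpmul2l => //.
by rewrite lee_fin ltW // (doubling_gt0 x).
Qed.

(** Otherwise a greedy choice gives an infinite [e]-separated sequence in the ball. The balls of
    radius [e / 3] around its points are disjoint, lie in [cball d x (T + e)], and by doubling each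
    carries a fixed fraction of its measure, which bounds their number. *)
Lemma total_bounded x T e : 0 < T -> 0 < e ->
  exists n (c : nat -> X), cball d x T `<=` \bigcup_(k in [set k | (k < n)%N]) [set y | d (c k) y < e].
Proof.
move=> T0 e0; apply: contrapT => hno.
have far (s : seq X) : exists y, d x y <= T /\ (forall c, List.In c s -> e <= d c y).
  apply: contrapT => hs; apply: hno; exists (size s), (nth x s) => y xy.
  apply: contrapT => hy; apply: hs; exists y; split => // c cs.
  rewrite leNgt; apply/negP => cy; apply: hy.
  have [k kn kc] : exists2 k, (k < size s)%N & nth x s k = c.
    elim: (s) cs => //= a t IH [->|/IH [k kt <-]]; first by exists 0%N.
    by exists k.+1.
  by exists k => //=; rewrite kc.
have [f hf] := choice far.
pose s := fix s n := if n is n'.+1 then f (s n') :: s n' else [::].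
pose u n := f (s n).
have uin m n : (m < n)%N -> List.In (u m) (s n).
  elim: n => // n IH; rewrite ltnS leq_eqVlt => /orP[/eqP ->|/IH]; first by left.
  by right.
have sep m n : (m < n)%N -> e <= d (u m) (u n).
  by move=> mn; have [_ h] := hf (s n); apply: h; exact: uin.
have e3 : 0 < e / 3 by lra.
(* The ball of radius [2 * T + e] around any [u k] contains [cball d x (T + e)]; doubling the radius
   [e / 3] [N] times reaches it. *)
have [N hN] : exists N, 2 * T + e <= 2 ^+ N * (e / 3).
  exists (Num.truncn ((2 * T + e) / (e / 3))).+1.
  rewrite -ler_pdivrMr //; apply: le_trans (ltW (truncnS_gt _)) _.
  by rewrite -natrX ler_nat ltnW // ltn_expl.
pose M := fine (mu (cball d x (T + e))).
have Te : 0 < T + e by lra.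
have M0 : 0 < M by apply: cball_fine_gt0.
have CN : 0 < Cd ^+ N by apply: exprn_gt0; exact: doubling_gt0 x.
have small k : M / Cd ^+ N <= fine (mu (cball d (u k) (e / 3))).
  rewrite ler_pdivrMr // mulrC -lee_fin EFinM -!cball_fineK //.
  apply: le_trans (doubling_iter _ _ e3).
  apply: mu_le; try exact: measurable_cball.
  move=> y; rewrite /cball /= => xy; apply: le_trans hN.
  have [h _] := hf (s k); rewrite -/(u k) in h.
  by have := dist_triangle hd x (u k) y; rewrite (distC hd (u k) x); lra.
have big n : n%:R * (M / Cd ^+ N) <= M.
  rewrite -lee_fin (_ : M%:E = mu (cball d x (T + e))); last by rewrite cball_fineK.
  apply: le_trans (_ : mu (\big[setU/set0]_(k < n) cball d (u k) (e / 3)) <= _)%E.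
    rewrite (@measure_bigsetU _ _ _ mu (fun k => cball d (u k) (e / 3))); last 2 first.
    - by move=> k; exact: measurable_cball.
    - apply/trivIsetP => i j _ _ ij.
      apply/seteqP; split => // y []; rewrite /cball /= => h1 h2.
      wlog {ij} : i j h1 h2 / (i < j)%N.
        move=> hw; move: ij; rewrite neq_ltn => /orP[] ij; first exact: (hw i j).
        exact: (hw j i).
      move=> /sep; have := dist_triangle hd y (u i) (u j).
      by rewrite (distC hd y (u j)); lra.
    apply: le_trans (_ : (\sum_(i < n) (M / Cd ^+ N)%:E <= _)%E).
      by rewrite sumEFin lee_fin sumr_const card_ord mulr_natl.
    by apply: lee_sum => i _; have := small i; rewrite -lee_fin -cball_fineK.
  apply: mu_le; [|exact: measurable_cball|].
    by apply: bigsetU_measurable => k _; exact: measurable_cball.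
  rewrite -(bigcup_mkord n (fun k => cball d (u k) (e / 3))) => y [k _]; rewrite /cball /= => h.
  have [h' _] := hf (s k); rewrite -/(u k) in h'.
  by have := dist_triangle hd (u k) x y; lra.
have := big (Num.truncn (Cd ^+ N)).+1.
rewrite mulrA ler_pdivrMr // (mulrC M) ler_pM2r // leNgt.
by rewrite truncnS_gt.
Qed.

(** Without a finite subcover of [K], total boundedness gives nested parts [P n] of [K] that have
    none either, [P n.+1] lying in a ball of radius 1/(n+1). Completeness supplies a limit [l] of
    points chosen in them, and the member of the cover that contains [l] swallows a whole [P n]. *)
Lemma closed_bounded_dcompact (hcomp : dcomplete d) (K : set X) x0 T : 0 < T ->
  K !=set0 -> dclosure d K `<=` K -> K `<=` cball d x0 T -> dcompact d K.
Proof.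
move=> T0 [a Ka] cK bK I U oU KU.
(* A default index is required to give the empty set a finite subcover, since a subcover is a total
   function [nat -> I]. *)
have [i0 _ _] := KU _ Ka.
pose fincov (P : set X) := exists n (f : nat -> I), P `<=` \bigcup_(k in [set k | (k < n)%N]) U (f k).
rewrite -/(fincov K); apply: contrapT => badK.
have fincov0 : fincov set0 by exists 0%N, (fun=> i0).
have fincovU P Q : fincov P -> fincov Q -> fincov (P `|` Q).
  move=> [n [f hf]] [m [g hg]].
  exists (n + m)%N, (fun k => if (k < n)%N then f k else g (k - n)%N).
  move=> y [/hf [k kn Uk]|/hg [k km Uk]].
    by exists k => /=; [exact: ltn_addr|rewrite kn].
  by exists (n + k)%N => /=; [rewrite ltn_add2l|rewrite ltnNge leq_addr /= addKn].
have fincovS P Q : P `<=` Q -> fincov Q -> fincov P.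
  by move=> PQ [n [f hf]]; exists n, f; exact: subset_trans hf.
have step (nP : nat * set X) : exists c, nP.2 `<=` K -> ~ fincov nP.2 ->
    ~ fincov (nP.2 `&` [set y | d c y < nP.1.+1%:R^-1]).
  case: nP => n P /=; have [PK|nPK] := pselect (P `<=` K); last by exists x0.
  apply: contrapT => hno.
  have good c : fincov (P `&` [set y | d c y < n.+1%:R^-1]).
    by apply: contrapT => h; apply: hno; exists c.
  have n0 : 0 < n.+1%:R^-1 :> R by rewrite invr_gt0 ltr0n.
  have [m [c hc]] := total_bounded x0 T0 n0.
  apply: hno; exists x0 => _ bP; exfalso; apply: bP.
  apply: (fincovS _ (\bigcup_(k in [set k | (k < m)%N]) (P `&` [set y | d (c k) y < n.+1%:R^-1]))).
    by move=> y Py; have [k km ky] := hc _ (bK _ (PK _ Py)); exists k.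
  rewrite bigcup_mkord; elim: m {hc} => [|m IH]; first by rewrite big_ord0.
  by rewrite big_ord_recr /=; apply: fincovU.
have [c hc] := choice step.
pose P := fix P n := if n is n'.+1 then P n' `&` [set y | d (c (n', P n')) y < n'.+1%:R^-1] else K.
have PS n : P n.+1 = P n `&` [set y | d (c (n, P n)) y < n.+1%:R^-1] by [].
have PK n : P n `<=` K by elim: n => // n IH y [/IH].
have Pbad n : ~ fincov (P n).
  by elim: n => [//|n IH]; rewrite PS; exact: (hc (n, P n) (PK n) IH).
have Pmono m n : (m <= n)%N -> P n `<=` P m.
  move=> /subnK <-; elim: (n - m)%N => // k IH y; rewrite addSn PS => -[h _]; exact: IH.
have Pne n : exists y, P n y.
  apply: contrapT => h; apply: (Pbad n).
  by apply: (fincovS _ set0) => // y Py; exfalso; apply: h; exists y.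
have [y Py] := choice Pne.
have diam n z w : P n.+1 z -> P n.+1 w -> d z w < 2 * n.+1%:R^-1.
  rewrite PS => -[_ /= h1] [_ /= h2].
  have := dist_triangle hd (c (n, P n)) z w; rewrite (distC hd z (c _)).
  by move: h1 h2; set q := (n.+1%:R^-1); lra.
have [|l hl] := hcomp y.
  move=> e e0; have e2 : 0 < e / 2 by lra.
  have [N hN] := natSinv_lt e2; exists N.+1 => m n Nm Nn.
  apply: lt_le_trans (diam N _ _ _ _) _.
  - by apply: (Pmono _ m) => //.
  - by apply: (Pmono _ n) => //.
  - by have := hN N (leqnn _); set q := (N.+1%:R^-1); lra.
have Kl : K l.
  apply: cK => e e0; have [N hN] := hl e e0.
  by exists (y N); [exact: (PK N)|rewrite (distC hd); exact: hN].
have [i _ Ui] := KU _ Kl.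
have [r [r0 hr]] := oU i _ Ui.
have r4 : 0 < r / 4 by lra.
have [N1 hN1] := natSinv_lt r4; have [N2 hN2] := hl (r / 4) r4.
pose N := maxn N1 N2.
apply: (Pbad N.+1); exists 1%N, (fun=> i) => z Pz; exists 0%N => //; apply: hr => /=.
have h1 := hN1 N (leq_maxl _ _).
have h2 := hN2 N.+1 (leqW (leq_maxr _ _)).
have h3 := diam _ _ _ (Py N.+1) Pz.
have := dist_triangle hd (y N.+1) l z; rewrite (distC hd l (y _)).
move: h1 h3; set q := (N.+1%:R^-1); lra.
Qed.

(* Shrinking the exponent from [s] to [q] is harmless because all radii are at most 1. *)
Lemma haus_content_finite_cover (F : set X) s q tau : dcompact d F ->
  q <= s -> haus_content d mu s 1 F = 0%E -> 0 < tau ->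
  exists (l : seq nat) (c : nat -> X) (r : nat -> R),
  [/\ forall k, k \in l -> 0 < r k <= 1,
      forall k, k \in l -> exists2 y, F y & d (c k) y <= r k,
      forall y, F y -> exists2 k, k \in l & d (c k) y < 3 / 2 * r k &
      (\sum_(k <- l) (r k `^ (- q))%:E * mu (cball d (c k) (r k)) < tau%:E)%E].
Proof.
move=> cF qs F0 tau0.
have : (haus_content d mu s 1 F < tau%:E)%E by rewrite F0 lte_fin.
move=> /ereal_inf_lt [_ [I [c [r [hI [FI ->]]]]] hsum].
(* Balls that miss [F] are discarded, so that the centre of each remaining ball is within its radius
   of [F]. The enlargement by 3/2 turns the closed balls into an open cover. *)
pose I' k := I k /\ exists2 y, F y & d (c k) y <= r k.
pose U k := [set y | I' k /\ d (c k) y < 3 / 2 * r k].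
have [||n [f hf]] := cF nat U.
- move=> k; have [Ik|nIk] := pselect (I' k); last by move=> y [].
  move=> y [_ ky]; have [e [e0 he]] := dopen_ball hd ky.
  by exists e; split => // z zy; split => //; exact: he.
- move=> y Fy; have [k Ik ky] := FI _ Fy; exists k => //; split.
    by split => //; exists y.
  have [r0 _] := hI _ Ik; move: ky; rewrite /cball /=; lra.
(* Duplicates are removed because each ball may be counted only once in the comparison with the sum
   over [I]. *)
pose l := undup [seq k <- [seq f k | k <- iota 0 n] | `[< I' k >]].
have lI k : k \in l -> I' k.
  by rewrite mem_undup mem_filter => /andP[/asboolP].
exists l, c, r; split.
- by move=> k /lI [Ik _]; have [-> ->] := hI _ Ik.
- by move=> k /lI [].
- move=> y /hf [k /= kn [Ik ky]]; exists (f k) => //.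
  rewrite mem_undup mem_filter; apply/andP; split; first exact/asboolP.
  by apply: map_f; rewrite mem_iota.
apply: le_lt_trans hsum.
apply: le_trans (_ : (\sum_(k <- l) (r k `^ (- s))%:E * mu (cball d (c k) (r k)) <= _)%E).
  rewrite big_seq [leRHS]big_seq; apply: lee_sum => k /lI [Ik _].
  have [r0 r1] := hI _ Ik.
  apply: lee_wpmul2r => //; rewrite lee_fin.
  by apply: ger_powR; [rewrite r0 r1|rewrite lerN2].
rewrite fsbig_seq ?undup_uniq //; apply: esum_ge; exists [set` l] => //.
by split => //= k /= /lI [].
Qed.

End Compactness.

(** * Real estimates *)

Section RealEstimates.
Context {R : realType}.
Implicit Types (a b p q r s t x y z : R).

(** Young's inequality for the product of x^a and 1, with the conjugate exponents 1/a and 1/(1 -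
    a). *)
Lemma powR_bernoulli x a : 0 < x -> 0 < a -> a < 1 -> x `^ a <= 1 + a * (x - 1).
Proof.
move=> x0 a0 a1.
have ai0 : 0 < a^-1 by rewrite invr_gt0.
have bi0 : 0 < (1 - a)^-1 by rewrite invr_gt0 subr_gt0.
have conj : (a^-1)^-1 + ((1 - a)^-1)^-1 = 1 by rewrite !invrK; lra.
have := conjugate_powR (powR_ge0 x a) ler01 ai0 bi0 conj.
rewrite mulr1 powR1 -powRrM divff ?gt_eqF // powRr1 ?(ltW x0) //.
rewrite !invrK.
lra.
Qed.

Lemma powRD_gt0 x r s : 0 < x -> x `^ (r + s) = x `^ r * x `^ s.
Proof. by move=> x0; rewrite powRD // (gt_eqF x0) implybT. Qed.

Lemma powRB_gt0 x r s : 0 < x -> x `^ (r - s) = x `^ r / x `^ s.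
Proof. by move=> x0; rewrite powRB // (gt_eqF x0) implybT. Qed.

(** The weight W of the test function. Its branches cross at [t = r], where both equal r^(-a); for
    positive [a], log W as a function of log t has slope a below [r] and -a above. *)
Definition bump_weight a r t := Num.min (t `^ (- a)) (r `^ (- (2 * a)) * t `^ a).

Lemma bump_weight_gt0 a r t : 0 < r -> 0 < t -> 0 < bump_weight a r t.
Proof. by move=> r0 t0; rewrite /bump_weight lt_min powR_gt0 // mulr_gt0 // powR_gt0. Qed.

Lemma bump_weight_le a r t : 0 < a -> 0 < r -> 0 < t -> bump_weight a r t <= r `^ (- a).
Proof.
move=> a0 r0 t0; rewrite /bump_weight ge_min; case: (leP r t) => rt; apply/orP; [left|right].
  by rewrite !powRN lef_pV2 ?posrE ?powR_gt0 // ge0_ler_powR // ?nnegrE ?(ltW a0) ?(ltW r0) ?(ltW t0).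
have -> : - a = - (2 * a) + a by lra.
rewrite powRD_gt0 //.
by rewrite ler_pM2l ?powR_gt0 // ge0_ler_powR // ?nnegrE ?(ltW a0) ?(ltW r0) ?(ltW t0) // ltW.
Qed.

(** Each branch is a power of exponent [a] or [- a], so it changes by at most the factor (t/s)^a
    between [s] and [t]; the minimum inherits this. *)
Lemma bump_weight_ratio a r s t : 0 < a -> 0 < r -> 0 < s -> s <= t ->
  bump_weight a r t <= (t / s) `^ a * bump_weight a r s /\
  bump_weight a r s <= (t / s) `^ a * bump_weight a r t.
Proof.
move=> a0 r0 s0 st; have t0 : 0 < t by apply: lt_le_trans st.
have sn : s != 0 by rewrite gt_eqF.
have tn : t != 0 by rewrite gt_eqF.
have c1 : 1 <= (t / s) `^ a.
  rewrite -(powRr0 (t / s)) ler_powR //; last exact: ltW.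
  by rewrite ler_pdivlMr // mul1r.
have c0 : 0 <= (t / s) `^ a by apply: powR_ge0.
have ta : t `^ a = (t / s) `^ a * s `^ a.
  by rewrite -powRM ?divfK // ?divr_ge0 ?(ltW s0) ?(ltW t0).
have sta : s `^ a <= t `^ a by rewrite ge0_ler_powR // ?nnegrE ?(ltW a0) ?(ltW s0) ?(ltW t0).
have sa : s `^ (- a) = (t / s) `^ a * t `^ (- a).
  rewrite !powRN ta invfM mulrA divff ?mul1r //.
  by rewrite gt_eqF // powR_gt0 // divr_gt0.
have tsa : t `^ (- a) <= s `^ (- a).
  by rewrite sa ler_peMl // powR_ge0.
rewrite /bump_weight !minr_pMr // !le_min !ge_min; split; apply/andP; split; apply/orP.
- by left; apply: le_trans tsa _; rewrite ler_peMl // powR_ge0.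
- by right; rewrite ta mulrCA.
- by left; rewrite sa.
- right; rewrite mulrCA ler_pM2l ?powR_gt0 //.
  by apply: le_trans sta _; rewrite ler_peMl // powR_ge0.
Qed.

(** The integrated form of |W'| <= a W / t: the ratio bound combined with Bernoulli's inequality for
    (t/s)^a. Any common upper bound [w] of the two values may stand for W. *)
Lemma bump_weight_lip a r s t w : 0 < a -> a < 1 -> 0 < r -> 0 < s -> s <= t ->
  bump_weight a r s <= w -> bump_weight a r t <= w ->
  `|bump_weight a r t - bump_weight a r s| <= a * w / s * (t - s).
Proof.
move=> a0 a1 r0 s0 st sw tw.
have t0 : 0 < t by apply: lt_le_trans st.
have [h1 h2] := bump_weight_ratio a0 r0 s0 st.
have Ws := bump_weight_gt0 a r0 s0; have Wt := bump_weight_gt0 a r0 t0.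
have B := powR_bernoulli (divr_gt0 t0 s0) a0 a1.
have -> : a * w / s * (t - s) = a * (t / s - 1) * w by field; rewrite gt_eqF.
have e0 : 0 <= a * (t / s - 1).
  by rewrite mulr_ge0 ?(ltW a0) // subr_ge0 ler_pdivlMr // mul1r.
move: B e0 h1 h2 Ws Wt sw tw.
set e := a * (t / s - 1); set P := (t / s) `^ a.
set x := bump_weight a r s; set y := bump_weight a r t.
move=> B e0 h1 h2 Ws Wt sw tw.
have k1 : P * x <= x + e * w.
  apply: le_trans (_ : (1 + e) * x <= _); first by rewrite ler_pM2r.
  by rewrite mulrDl mul1r lerD2l ler_wpM2l.
have k2 : P * y <= y + e * w.
  apply: le_trans (_ : (1 + e) * y <= _); first by rewrite ler_pM2r.
  by rewrite mulrDl mul1r lerD2l ler_wpM2l.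
rewrite ler_norml; lra.
Qed.

(** One bound for each branch: the first serves at the scale of the outer cutoff, the second at the
    holes. *)
Lemma bump_weight_powR a r t p : 0 < r -> 0 < t -> 0 <= p ->
  bump_weight a r t `^ p <= t `^ (- (a * p)) /\
  bump_weight a r t `^ p <= r `^ (- (2 * (a * p))) * t `^ (a * p).
Proof.
move=> r0 t0 p0; have W0 := bump_weight_gt0 a r0 t0; split.
  rewrite -mulNr powRrM ge0_ler_powR // ?nnegrE ?powR_ge0 ?(ltW W0) //.
  by rewrite /bump_weight ge_min lexx.
rewrite mulrA -mulNr !powRrM -powRM ?powR_ge0 //.
rewrite ge0_ler_powR // ?nnegrE ?(ltW W0) ?mulr_ge0 ?powR_ge0 //.
by rewrite /bump_weight ge_min lexx orbT.
Qed.

(** Below [r] the increasing branch is the minimum, so the right side is r^(-2ap) t^(ap - q). This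
    is nonincreasing in t because [a * p <= q], and at [t = r] it equals the left side. *)
Lemma bump_weight_powR_ge a r t p q : 0 < r -> 0 < t -> t <= r -> 0 <= p -> 0 < a ->
  a * p <= q ->
  r `^ (- (q + a * p)) <= bump_weight a r t `^ p * t `^ (- q).
Proof.
move=> r0 t0 tr p0 a0 apq.
have -> : bump_weight a r t = r `^ (- (2 * a)) * t `^ a.
  rewrite /bump_weight min_r //.
  have ap x : 0 < x -> x `^ (- (2 * a)) * x `^ a = x `^ (- a).
    by move=> x0; rewrite -powRD_gt0 //; congr (_ `^ _); lra.
  rewrite -(ap t t0) ler_pM2r ?powR_gt0 //.
  rewrite !powRN lef_pV2 ?posrE ?powR_gt0 // ge0_ler_powR // ?nnegrE ?(ltW r0) ?(ltW t0) //.
  by rewrite mulr_ge0 // ltW.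
rewrite powRM ?powR_ge0 // -!powRrM -mulrA -powRD_gt0 //.
have -> : - (q + a * p) = - (2 * a) * p + (a * p - q) by lra.
rewrite (powRD_gt0 _ _ r0) ler_pM2l ?powR_gt0 //.
rewrite -(opprB q) !powRN lef_pV2 ?posrE ?powR_gt0 // ge0_ler_powR // ?nnegrE ?(ltW r0) ?(ltW t0) //.
by rewrite subr_ge0.
Qed.

Lemma ratio_near (l x x0 : R) : 1 < l -> 0 < x0 -> `|x0 - x| <= (1 - l^-1) * x0 ->
  x <= l * x0 /\ x0 <= l * x.
Proof.
move=> l1 x00; have l0 : 0 < l by lra.
rewrite ler_norml => /andP[h1 h2].
have li1 : l^-1 <= 1 by rewrite invf_le1 // ltW.
split.
  apply: le_trans (_ : (2 - l^-1) * x0 <= _); first by lra.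
  rewrite ler_pM2r //.
  have h : 0 <= (l - 1) ^+ 2 / l by rewrite divr_ge0 ?sqr_ge0 // ltW.
  have : (l - 1) ^+ 2 / l = l - 2 + l^-1 by field; rewrite gt_eqF.
  lra.
have : l^-1 * x0 <= x by lra.
by rewrite -(ler_pM2l l0) mulrA divff ?gt_eqF // mul1r.
Qed.

Lemma exprn_lip n x y B : 0 <= x -> x <= B -> 0 <= y -> y <= B ->
  `|x ^+ n.+1 - y ^+ n.+1| <= n.+1%:R * B ^+ n * `|x - y|.
Proof.
move=> x0 xB y0 yB; have B0 : 0 <= B by lra.
rewrite subrXX normrM mulrC ler_wpM2r //.
apply: le_trans (ler_norm_sum _ _ _) _.
apply: le_trans (_ : \sum_(i < n.+1) B ^+ n <= _); last first.
  by rewrite sumr_const card_ord mulr_natl.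
apply: ler_sum => i _; rewrite ger0_norm ?mulr_ge0 ?exprn_ge0 //.
have -> : B ^+ n = B ^+ (n - i) * B ^+ i.
  by rewrite -exprD subnK // -ltnS.
by apply: ler_pM; rewrite ?exprn_ge0 //; apply: lerXn2r; rewrite ?nnegrE.
Qed.

(** Absorption case: where [g] is at most [k * z / D], both terms of the gradient are small
    multiples of z^(n+1) W / D, the test function divided by the distance. *)
Lemma gradient_absorb p beta a k z D W g n : 0 <= p -> 0 < D -> 0 <= z -> 0 <= W ->
  0 <= a -> 0 <= k -> 0 <= g -> g * D <= k * z ->
  (4 * z ^+ n * W * (n.+1%:R * g + a * z / D)) `^ p * D `^ beta
  <= (4 * (n.+1%:R * k + a)) `^ p * ((z ^+ n.+1 * W) `^ p * D `^ (beta - p)).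
Proof.
move=> p0 D0 z0 W0 a0 k0 g0 gD.
have c0 : 0 <= 4 * (n.+1%:R * k + a) by rewrite mulr_ge0 // addr_ge0 // mulr_ge0 // ler0n.
have v0 : 0 <= z ^+ n.+1 * W by rewrite mulr_ge0 // exprn_ge0.
rewrite mulrA -powRM // powRB_gt0 // mulrA (mulrAC _ (D `^ beta)).
apply: ler_wpM2r; first exact: powR_ge0.
rewrite -[(D `^ p)^-1]powRN -[- p]mulN1r powRrM powR_inv1 ?(ltW D0) // -powRM ?invr_ge0 ?(ltW D0) //; last exact: mulr_ge0.
rewrite ge0_ler_powR // ?nnegrE.
- by rewrite !mulr_ge0 ?exprn_ge0 // addr_ge0 ?mulr_ge0 ?ler0n ?invr_ge0 // ltW.
- by rewrite !mulr_ge0 ?invr_ge0 ?exprn_ge0 // ?addr_ge0 ?mulr_ge0 ?ler0n // ltW.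
have -> : 4 * (n.+1%:R * k + a) * (z ^+ n.+1 * W) / D =
    4 * z ^+ n * W * ((n.+1%:R * k + a) * (z / D)).
  by rewrite exprS; field; rewrite gt_eqF.
apply: ler_wpM2l; first by rewrite !mulr_ge0 ?exprn_ge0.
rewrite mulrDl; apply: lerD; last by rewrite mulrA.
by rewrite -mulrA ler_wpM2l ?ler0n // mulrA ler_pdivlMr.
Qed.

(** The opposite case: [z / D] is now at most [g / k], so the gradient is bounded by a multiple of g
    z^n W. After W^p <= M D^s it remains to trade z^(np) D^(beta + s) for a power of [g]. *)
Lemma gradient_residual p beta s a k z D W g n M N : 1 <= p -> 0 < D -> 0 < z -> z <= 1 ->
  0 <= W -> 0 <= a -> 0 < k -> k <= 1 -> 0 < g -> 1 <= N -> 0 <= M -> W `^ p <= M * D `^ s ->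
  k * z <= g * D -> g * D <= N -> - (beta + s) <= n%:R ->
  (4 * z ^+ n * W * (n.+1%:R * g + a * z / D)) `^ p * D `^ beta
  <= (4 * (n.+1%:R + a / k)) `^ p * (N / k) `^ `|beta + s| * M * g `^ (p - (beta + s)).
Proof.
move=> p1 D0 z0 z1 W0 a0 k0 k1 g0 N1 M0 WM kz gN bn.
have p0 : 0 <= p by lra.
have N0 : 0 < N by lra.
set b := beta + s.
have zn0 : 0 <= z ^+ n by rewrite exprn_ge0 // ltW.
have c0 : 0 <= 4 * (n.+1%:R + a / k).
  by rewrite mulr_ge0 // addr_ge0 ?ler0n // divr_ge0 // ltW.
have zD : z / D <= g / k by rewrite ler_pdivrMr // mulrAC ler_pdivlMr // mulrC.
apply: le_trans (_ : ((4 * (n.+1%:R + a / k)) * (g * (z ^+ n * W))) `^ p * D `^ beta <= _).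
  apply: ler_wpM2r; first exact: powR_ge0.
  rewrite ge0_ler_powR // ?nnegrE.
  - by rewrite !mulr_ge0 // addr_ge0 ?mulr_ge0 ?ler0n ?invr_ge0 // ltW.
  - by rewrite mulr_ge0 // mulr_ge0 ?mulr_ge0 // ltW.
  have -> : 4 * (n.+1%:R + a / k) * (g * (z ^+ n * W)) = 4 * z ^+ n * W * ((n.+1%:R + a / k) * g).
    by ring.
  apply: ler_wpM2l; first by rewrite !mulr_ge0.
  by rewrite mulrDl lerD2l -!mulrA ler_wpM2l // [k^-1 * g]mulrC.
set c := 4 * (n.+1%:R + a / k) in c0 *.
have zW0 : 0 <= z ^+ n * W by rewrite mulr_ge0.
rewrite (powRM _ c0 (mulr_ge0 (ltW g0) zW0)) (powRM _ (ltW g0) zW0) (powRM _ zn0 W0).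
rewrite -!mulrA ler_wpM2l ?powR_ge0 //.
apply: le_trans (_ : g `^ p * (M * ((z ^+ n) `^ p * D `^ b)) <= _).
  rewrite ler_wpM2l ?powR_ge0 // [leRHS]mulrCA ler_wpM2l ?powR_ge0 //.
  by rewrite /b powRD_gt0 // [D `^ beta * _]mulrC mulrA ler_wpM2r ?powR_ge0.
rewrite powRB_gt0 //.
suff key : (z ^+ n) `^ p * D `^ b <= (N / k) `^ `|b| / g `^ b.
  have -> : (N / k) `^ `|b| * (M * (g `^ p / g `^ b)) = g `^ p * (M * ((N / k) `^ `|b| / g `^ b)) by ring.
  by rewrite ler_wpM2l ?powR_ge0 // ler_wpM2l.
rewrite ler_pdivlMr ?powR_gt0 // -mulrA -powRM ?(ltW D0) ?(ltW g0) // [D * g]mulrC.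
have gD0 : 0 < g * D by rewrite mulr_gt0.
have powR1E x : 1 `^ x = 1 :> R by rewrite powR1.
have zp1 : (z ^+ n) `^ p <= 1.
  rewrite -[leRHS](powR1E p) ge0_ler_powR // ?nnegrE //.
  by rewrite exprn_ile1 // ltW.
(* For b >= 0 the bound [g * D <= N] suffices. For b < 0 the lower bound [k * z <= g * D] brings in
   a negative power of [z], which z^(np) compensates since n p >= n >= -b; this is the purpose of
   the high power of the cutoff. *)
case: (leP 0 b) => b0.
  rewrite ger0_norm //; apply: le_trans (_ : 1 * (g * D) `^ b <= _).
    by rewrite ler_wpM2r ?powR_ge0.
  rewrite mul1r ge0_ler_powR // ?nnegrE ?(ltW gD0) ?divr_ge0 ?(ltW N0) ?(ltW k0) //.
  by apply: le_trans gN _; rewrite ler_pdivlMr // ler_piMr // ltW.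
rewrite ltr0_norm //.
have zb : (z ^+ n) `^ p <= z `^ (- b).
  rewrite -powR_mulrn ?(ltW z0) // -powRrM.
  apply: ger_powR; first by rewrite z0 z1.
  apply: le_trans bn _; rewrite ler_peMr ?ler0n //.
have Db : (g * D) `^ b <= (k * z) `^ b.
  rewrite -[b]opprK !(powRN _ (- b)) lef_pV2 ?posrE ?powR_gt0 ?mulr_gt0 //.
  by rewrite ge0_ler_powR // ?nnegrE ?mulr_ge0 ?(ltW g0) ?(ltW D0) ?(ltW k0) ?(ltW z0) //; lra.
apply: le_trans (ler_pM _ _ zb Db) _; rewrite ?powR_ge0 //.
rewrite powRM ?(ltW k0) ?(ltW z0) // mulrCA -powRD_gt0 // addNr powRr0 mulr1.
rewrite powRM ?invr_ge0 ?(ltW k0) ?(ltW N0) // -[leLHS]mul1r.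
have -> : k `^ b = k^-1 `^ (- b).
  by rewrite -powR_inv1 ?(ltW k0) // -powRrM mulN1r opprK.
rewrite ler_wpM2r ?powR_ge0 // -[leLHS](powR1E (- b)).
by rewrite ge0_ler_powR // ?nnegrE ?(ltW N0) //; lra.
Qed.
End RealEstimates.

(** * The test function *)

Ltac pos := repeat first [done | exact: ltW | exact: powR_ge0 | exact: ler0n |
  apply: exprn_gt0 | apply: exprn_ge0 | apply: mulr_gt0 | apply: mulr_ge0 |
  apply: addr_ge0 | (rewrite invr_gt0) | (rewrite invr_ge0) | apply: powR_gt0].

Lemma bump_weight_dist (R : realType) (a r m w s t : R) : 0 < a -> a < 1 -> 0 < r -> 0 < m ->
  m <= s -> m <= t -> bump_weight a r s <= w -> bump_weight a r t <= w ->
  `|bump_weight a r t - bump_weight a r s| <= a * w / m * `|t - s|.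
Proof.
move=> a0 a1 r0 m0.
have key s' t' : m <= s' -> s' <= t' -> bump_weight a r s' <= w -> bump_weight a r t' <= w ->
    `|bump_weight a r t' - bump_weight a r s'| <= a * w / m * `|t' - s'|.
  move=> ms st sw tw; have s0 : 0 < s' by lra.
  apply: le_trans (bump_weight_lip a0 a1 r0 s0 st sw tw) _.
  rewrite ger0_norm ?subr_ge0 //; apply: ler_wpM2r; first by rewrite subr_ge0.
  have w0 : 0 <= w by apply: le_trans sw; exact/ltW/bump_weight_gt0.
  by apply: ler_wpM2l; rewrite ?mulr_ge0 ?(ltW a0) // lef_pV2.
move=> ms mt sw tw; case: (leP s t) => st; first exact: key.
by rewrite distrC [`|t - s|]distrC; apply: key => //; exact: ltW.
Qed.

Lemma exists_root_gt1 (R : realType) k : exists2 l : R, 1 < l & l ^+ k.+1 * l ^+ k.+1 = 4.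
Proof.
have k0 : 0 < k.+1%:R^-1 :> R by rewrite invr_gt0 ltr0n.
exists (2 `^ k.+1%:R^-1).
  have : 1 `^ k.+1%:R^-1 < (2 : R) `^ k.+1%:R^-1.
    by apply: (gt0_ltr_powR k0); rewrite ?nnegrE //; lra.
  by rewrite powR1.
have -> : (2 `^ k.+1%:R^-1) ^+ k.+1 = 2 :> R.
  by rewrite -powR_mulrn ?powR_ge0 // -powRrM mulVf ?powRr1 // pnatr_eq0.
by rewrite -natrM.
Qed.

Section TestFunction.
Context {R : realType} {dX : measure_display} {X : measurableType dX}.
Variables (d : X -> X -> R) (hd : is_metric d) (hB : borel_sigma d).
Variables (zeta D gz : X -> R) (Lz m0 a r : R) (n : nat).
Hypotheses (z01 : forall y, 0 <= zeta y <= 1)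
  (zlip : forall y z, `|zeta y - zeta z| <= Lz * d y z)
  (m00 : 0 < m0) (Dm : forall y, m0 <= D y)
  (Dlip : forall y z, `|D y - D z| <= d y z)
  (g0 : forall y, 0 <= gz y) (mgz : measurable_fun setT gz)
  (zloc : forall y, exists2 rho, 0 < rho & exists2 A, 0 <= A &
     forall z, d y z < rho -> `|zeta y - zeta z| <= A * d y z /\ A <= gz z)
  (a0 : 0 < a) (a1 : a < 1) (r0 : 0 < r) (n0 : (0 < n)%N).

Let W t := bump_weight a r t.
Definition test_fun y := zeta y ^+ n.+1 * bump_weight a r (D y).
(** The product rule for [test_fun], with [gz] for the gradient of [zeta] and a W / D for that of
    the weight, times a slack factor. *)
Definition test_grad y :=
  4 * zeta y ^+ n * bump_weight a r (D y) * (n.+1%:R * gz y + a * zeta y / D y).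

Let D0 y : 0 < D y. Proof. exact: lt_le_trans (Dm y). Qed.
Let W0 y : 0 < W (D y). Proof. exact: bump_weight_gt0. Qed.
Let z0 y : 0 <= zeta y. Proof. by case/andP: (z01 y). Qed.
Let z1 y : zeta y <= 1. Proof. by case/andP: (z01 y). Qed.

Lemma test_fun_diff y z B w m : zeta y <= B -> zeta z <= B -> m <= D y -> m <= D z ->
  0 < m -> W (D y) <= w -> W (D z) <= w ->
  `|test_fun y - test_fun z| <=
    n.+1%:R * B ^+ n * `|zeta y - zeta z| * w + B ^+ n.+1 * (a * w / m) * d y z.
Proof.
move=> yB zB my mz m1 yw zw.
have -> : test_fun y - test_fun z =
    (zeta y ^+ n.+1 - zeta z ^+ n.+1) * W (D y) + zeta z ^+ n.+1 * (W (D y) - W (D z)).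
  by rewrite /test_fun -/(W _) -/(W _); ring.
have B0 : 0 <= B by apply: le_trans zB.
apply: le_trans (ler_normD _ _) _; rewrite !normrM; apply: lerD.
  by apply: ler_pM => //; [exact: exprn_lip|rewrite gtr0_norm].
rewrite -mulrA; apply: ler_pM => //.
  by rewrite ger0_norm ?exprn_ge0 //; apply: lerXn2r; rewrite ?nnegrE.
apply: le_trans (@bump_weight_dist _ a r m w _ _ a0 a1 r0 m1 mz my zw yw) _.
apply: ler_wpM2l (Dlip _ _).
by rewrite divr_ge0 ?mulr_ge0 ?(ltW a0) ?(ltW m1) //; apply: le_trans zw; exact: ltW.
Qed.

Lemma test_fun_lipschitz : Defs.lipschitz d test_fun.
Proof.
exists (n.+1%:R * Lz * r `^ (- a) + a * r `^ (- a) / m0) => y z.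
have Wr x : W (D x) <= r `^ (- a) by exact: bump_weight_le.
apply: le_trans (test_fun_diff (z1 y) (z1 z) (Dm y) (Dm z) m00 (Wr y) (Wr z)) _.
rewrite !expr1n mulr1 mul1r mulrDl lerD2r -!mulrA ler_wpM2l ?ler0n //.
by rewrite [leRHS]mulrCA [leLHS]mulrC ler_wpM2l ?powR_ge0.
Qed.

Lemma measurable_test_fun : measurable_fun setT test_fun.
Proof. exact/(measurable_lip hd hB)/test_fun_lipschitz. Qed.

Lemma measurable_bump_weight_comp : measurable_fun setT (fun y => W (D y)).
Proof.
apply: (measurable_lip hd hB); exists (a * r `^ (- a) / m0) => y z.
apply: le_trans (bump_weight_dist (w := r `^ (- a)) a0 a1 r0 m00 (Dm z) (Dm y) _ _) _.
- exact: bump_weight_le.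
- exact: bump_weight_le.
by apply: ler_wpM2l (Dlip y z); rewrite divr_ge0 ?mulr_ge0 ?powR_ge0 // ltW.
Qed.

Lemma measurable_test_grad : measurable_fun setT test_grad.
Proof.
have mz : measurable_fun setT zeta by apply: (measurable_lip hd hB); exists Lz.
have mD : measurable_fun setT D.
  by apply: (measurable_lip hd hB); exists 1 => y z; rewrite mul1r.
apply: measurable_funM.
  apply: measurable_funM; last exact: measurable_bump_weight_comp.
  by apply: measurable_funM => //; exact: measurable_funX.
apply: measurable_funD; first exact: measurable_funM.
apply: measurable_funM; first exact: measurable_funM.
rewrite (_ : (fun y => (D y)^-1) = (fun y => D y `^ (-1))); last first.
  by apply/funext => y; rewrite powR_inv1 // ltW.
by apply: (measurableT_comp (measurable_powR _)).
Qed.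

Lemma test_grad_ge0 y : 0 <= test_grad y.
Proof.
by rewrite /test_grad !mulr_ge0 ?exprn_ge0 ?(ltW (W0 y)) // addr_ge0 ?mulr_ge0 ?invr_ge0 ?ler0n ?(ltW a0) ?(ltW (D0 y)).
Qed.

(* Near a point where [zeta] is positive all factors are comparable up to [l],
   with [l ^+ (2 * n + 6) = 4]; this is where the factor 4 in [test_grad] comes from. *)
Lemma test_grad_upper : upper_gradient d test_fun (EFin \o test_grad).
Proof.
apply: (upper_gradient_local hd hB measurable_test_grad test_grad_ge0) => y e e0.
have Lzb x z : `|zeta x - zeta z| <= (`|Lz| + 1) * d x z.
  apply: le_trans (zlip x z) _; apply: ler_wpM2r; first exact: dist_ge0.
  by apply: le_trans (ler_norm _) _; rewrite lerDl.
have L0 : 0 < `|Lz| + 1 by have := normr_ge0 Lz; lra.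
have Wr x : W (D x) <= r `^ (- a) by exact: bump_weight_le.
have V0 : 0 < r `^ (- a) by rewrite powR_gt0.
(* At a zero of [zeta] the values nearby are not comparable, and the slope 0 is used. Since [n] is
   positive, the test function is at most a constant times zeta^2, hence quadratic in the distance,
   and the error [e] covers it. *)
have [zy|zy] := eqVneq (zeta y) 0.
  pose C := (`|Lz| + 1) ^+ 2 * r `^ (- a).
  have C0 : 0 < C by rewrite mulr_gt0 // exprn_gt0.
  exists (e / C); split; first by rewrite divr_gt0.
  exists 0 => // z yz; split; last exact: test_grad_ge0.
  rewrite add0r /test_fun zy expr0n mul0r sub0r normrN normrM.
  have h := Lzb z y; rewrite zy subr0 (distC hd) in h.
  have hz : `|zeta z ^+ n.+1| <= ((`|Lz| + 1) * d y z) ^+ 2.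
    rewrite ger0_norm ?exprn_ge0 //; apply: le_trans (_ : zeta z ^+ 2 <= _).
      by apply: ler_wiXn2l.
    by apply: lerXn2r; rewrite ?nnegrE ?mulr_ge0 ?(ltW L0) ?(dist_ge0 hd) //; apply: le_trans h; rewrite ler_norm.
  apply: le_trans (ler_pM _ _ hz _) _; [by []|by []|by rewrite gtr0_norm //; exact: Wr|].
  have -> : ((`|Lz| + 1) * d y z) ^+ 2 * r `^ (- a) = (C * d y z) * d y z by rewrite /C; ring.
  apply: ler_wpM2r; first exact: dist_ge0.
  by rewrite mulrC -ler_pdivlMr // ltW.
have zy0 : 0 < zeta y by rewrite lt_neqAle eq_sym zy z0.
have [rho rho0 [A A0 hA]] := zloc y.
have [l l1 lk] := exists_root_gt1 R n.+2.
have l0 : 0 < l by lra.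
have q0 : 0 < 1 - l^-1 by rewrite subr_gt0 invf_lt1.
(* Within this radius [zeta] and [D] change by at most the factor [l], and so does the weight
   because [a < 1]. *)
pose rr := Num.min rho (Num.min ((1 - l^-1) * zeta y / (`|Lz| + 1)) ((1 - l^-1) * D y)).
exists rr; split.
  by rewrite !lt_min rho0 divr_gt0 ?mulr_gt0.
pose P := zeta y ^+ n * W (D y).
have P0 : 0 < P by rewrite mulr_gt0 ?exprn_gt0.
pose Q := n.+1%:R * A + a * zeta y / D y.
have Q0 : 0 <= Q by rewrite addr_ge0 ?mulr_ge0 ?invr_ge0 ?ler0n ?(ltW a0) ?(ltW (D0 y)).
(* The upper estimate of the slope loses a factor [l] for each power of [zeta], for the weight and
   for [D], at most l^(n+3) in all. The lower estimate of [test_grad] loses as much, and the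
   constant 4 pays for both. *)
exists (l ^+ n.+3 * P * Q); first by pos.
move=> z; rewrite /rr !lt_min => /and3P[yz1 yz2 yz3].
have [hz Agz] := hA z yz1.
have [zz1 zz2] : zeta z <= l * zeta y /\ zeta y <= l * zeta z.
  apply: ratio_near => //; apply: le_trans (Lzb y z) _.
  by rewrite mulrC -ler_pdivlMr // ltW.
have [DD1 DD2] : D z <= l * D y /\ D y <= l * D z.
  by apply: ratio_near => //; apply: le_trans (Dlip y z) _; exact: ltW.
have la : l `^ a <= l by apply: ler1_powR; exact: ltW.
have [WW1 WW2] : W (D z) <= l * W (D y) /\ W (D y) <= l * W (D z).
  have key s t : 0 < s -> s <= t -> t <= l * s -> W t <= l * W s /\ W s <= l * W t.
    move=> s0 st tls; have t0 : 0 < t by lra.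
    have [h1 h2] := bump_weight_ratio a0 r0 s0 st.
    have h : (t / s) `^ a <= l.
      apply: le_trans la; apply: ge0_ler_powR; rewrite ?nnegrE ?divr_ge0 ?(ltW s0) ?(ltW t0) ?(ltW a0) ?(ltW l0) //.
      by rewrite ler_pdivrMr.
    by split; [apply: le_trans h1 _|apply: le_trans h2 _]; rewrite ler_wpM2r // ltW // bump_weight_gt0.
  case: (leP (D y) (D z)) => h; first exact: key.
  by have [] := key (D z) (D y) (D0 z) (ltW h) DD2.
have z0' : 0 < zeta z by rewrite -(pmulr_rgt0 _ l0); apply: lt_le_trans zz2.
split.
  apply: le_trans (test_fun_diff (B := l * zeta y) (w := l * W (D y)) (m := l^-1 * D y) _ zz1 _ _ _ _ WW1) _.
  - by rewrite ler_peMl // ltW.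
  - by rewrite ler_piMl ?(ltW (D0 y)) // invf_le1 // ltW.
  - by rewrite mulrC ler_pdivrMr // mulrC.
  - by pos.
  - by rewrite ler_peMl ?(ltW (W0 y)) // ltW.
  have -> : (l * zeta y) ^+ n.+1 * (a * (l * W (D y)) / (l^-1 * D y)) * d y z =
      l ^+ n.+3 * P * (a * zeta y / D y) * d y z.
    rewrite /P exprMn !exprS; field.
    by rewrite !gt_eqF.
  have -> : (l ^+ n.+3 * P * Q + e) * d y z = l ^+ n.+3 * P * (n.+1%:R * A) * d y z +
      l ^+ n.+3 * P * (a * zeta y / D y) * d y z + e * d y z by rewrite /Q; ring.
  have ed : 0 <= e * d y z by rewrite mulr_ge0 ?(dist_ge0 hd) // ltW.
  have dd : 0 <= d y z by exact: dist_ge0.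
  suff : n.+1%:R * (l * zeta y) ^+ n * `|zeta y - zeta z| * (l * W (D y)) <=
     l ^+ n.+3 * P * (n.+1%:R * A) * d y z by lra.
  apply: le_trans (_ : n.+1%:R * (l * zeta y) ^+ n * (A * d y z) * (l * W (D y)) <= _).
    apply: ler_wpM2r; first by pos.
    by apply: ler_wpM2l => //; rewrite mulr_ge0 ?ler0n // exprn_ge0 // mulr_ge0 // ltW.
  have -> : n.+1%:R * (l * zeta y) ^+ n * (A * d y z) * (l * W (D y)) =
      l ^+ n.+1 * (P * (n.+1%:R * A) * d y z) by rewrite /P exprMn exprS; ring.
  have -> : l ^+ n.+3 * P * (n.+1%:R * A) * d y z = l ^+ n.+3 * (P * (n.+1%:R * A) * d y z) by ring.
  apply: ler_wpM2r; last by apply: ler_weXn2l; [exact: ltW|exact: leq_trans (leqnSn _) (leqnSn _)].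
  exact: (mulr_ge0 (mulr_ge0 (ltW P0) (mulr_ge0 (ler0n _ _) A0)) dd).
apply: le_trans (_ : 4 * (l ^- n * zeta y ^+ n) * (l^-1 * W (D y)) * (n.+1%:R * A + a * (l^-1 * zeta y) / (l * D y)) <= _).
  apply: le_trans (_ : 4 * l ^- n.+3 * P * Q <= _).
    rewrite -lk.
    by rewrite mulfK // expf_neq0 // gt_eqF.
  have -> : 4 * (l ^- n * zeta y ^+ n) * (l^-1 * W (D y)) * (n.+1%:R * A + a * (l^-1 * zeta y) / (l * D y))
     = 4 * (l ^- n * l^-1) * P * (n.+1%:R * A + l ^- 2 * (a * zeta y / D y)).
    rewrite /P; field; rewrite !gt_eqF //.
    by rewrite exprn_gt0.
  have -> : 4 * l ^- n.+3 * P * Q = 4 * (l ^- n * l^-1) * P * (l ^- 2 * Q).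
    by rewrite !exprS; field; rewrite !gt_eqF // exprn_gt0.
  apply: ler_wpM2l; first by pos.
  rewrite /Q mulrDr lerD2r ler_piMl ?mulr_ge0 ?ler0n //.
  by rewrite invf_le1 ?exprn_gt0 // exprn_ege1 // ltW.
rewrite /test_grad -/(W _).
have li z' : 0 <= l^-1 * z' = (0 <= z') by rewrite pmulr_rge0 ?invr_gt0.
have y1 : l^-1 * zeta y <= zeta z by rewrite mulrC ler_pdivrMr // mulrC.
apply: ler_pM.
- by pos.
- by pos.
- apply: ler_pM.
  + by pos.
  + by pos.
  + apply: ler_wpM2l => //; rewrite -exprVn -exprMn; apply: lerXn2r => //; rewrite ?nnegrE //.
    by pos.
  + by rewrite mulrC ler_pdivrMr // mulrC.
apply: lerD; first by rewrite ler_wpM2l ?ler0n.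
apply: ler_pM.
- by pos.
- by pos.
- by rewrite ler_wpM2l // ltW.
- by rewrite lef_pV2 ?posrE ?mulr_gt0.
Qed.

End TestFunction.

(** * The Hardy inequality for the test function *)

Section HardyTest.
Context {R : realType} {dX : measure_display} {X : measurableType dX}.
Variables (d : X -> X -> R) (mu : {measure set X -> \bar R}) (Cd : R).
Hypotheses (hd : is_metric d) (hB : borel_sigma d) (hcomp : dcomplete d).
Hypotheses (hfin : balls_pos_finite d mu) (hdoub : doubling_with d mu Cd).
Variables (Omega : set X) (p beta CH : R).
Hypotheses (oO : dopen d Omega) (hardy : hardy_ineq d mu Omega p beta CH).
Hypotheses (p1 : 1 <= p) (bp : beta < p).
Variables (zeta D gz : X -> R) (Lz m0 a r : R) (n : nat).
Hypotheses (z01 : forall y, 0 <= zeta y <= 1)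
  (zlip : forall y z, `|zeta y - zeta z| <= Lz * d y z)
  (m00 : 0 < m0) (Dm : forall y, m0 <= D y)
  (Dlip : forall y z, `|D y - D z| <= d y z)
  (g0 : forall y, 0 <= gz y) (mgz : measurable_fun setT gz)
  (zloc : forall y, exists2 rho, 0 < rho & exists2 A, 0 <= A &
     forall z, d y z < rho -> `|zeta y - zeta z| <= A * d y z /\ A <= gz z)
  (a0 : 0 < a) (a1 : a < 1) (r0 : 0 < r) (n0 : (0 < n)%N).
Variables (x0 : X) (T k : R) (H : X -> R).
Hypotheses (T0 : 0 < T)
  (zT : forall y, zeta y != 0 -> d x0 y <= T)
  (zD : forall y, zeta y != 0 -> dist_compl d Omega y = (D y)%:E)
  (zO : dclosure d [set y | zeta y != 0] `<=` Omega)
  (k0 : 0 <= k) (kCH : (4 * (n.+1%:R * k + a)) `^ p * CH <= 2^-1)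
  (H0 : forall y, 0 <= H y) (mH : measurable_fun setT H)
  (gH : forall y, 0 < zeta y -> k * zeta y < gz y * D y ->
     test_grad zeta D gz a r n y `^ p * D y `^ beta <= H y).

Let v := test_fun zeta D a r n.
Let g := test_grad zeta D gz a r n.
Let V y := v y `^ p * D y `^ (beta - p).

Let D0 y : 0 < D y. Proof. exact: lt_le_trans (Dm y). Qed.
Let W0 y : 0 < bump_weight a r (D y). Proof. exact: bump_weight_gt0. Qed.
Let z0 y : 0 <= zeta y. Proof. by case/andP: (z01 y). Qed.
Let z1 y : zeta y <= 1. Proof. by case/andP: (z01 y). Qed.
Let pp0 : 0 < p. Proof. exact: lt_le_trans p1. Qed.
Let pn0 : p != 0. Proof. by rewrite gt_eqF. Qed.
Let p0 : 0 <= p. Proof. exact: ltW. Qed.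
Let v0 y : 0 <= v y.
Proof. by rewrite mulr_ge0 ?exprn_ge0 // ltW. Qed.
Let V0 y : 0 <= V y. Proof. by rewrite mulr_ge0 ?powR_ge0. Qed.

Let vE y : (v y != 0) = (zeta y != 0).
Proof. by rewrite /v /test_fun mulf_eq0 (gt_eqF (W0 y)) orbF expf_eq0. Qed.

Let compact_supp : (exists y, zeta y != 0) -> compact_support_in d v Omega.
Proof.
move=> [y zy].
rewrite /compact_support_in (_ : [set x | v x != 0] = [set x | zeta x != 0]); last first.
  by apply/seteqP; split=> x /=; rewrite vE.
split => //.
apply: (closed_bounded_dcompact hd hB hfin hdoub hcomp (x0 := x0) (T := T)) => //.
- by exists y => e e0; exists y => //; rewrite (distxx hd).
- move=> x hx e e0; have e2 : 0 < e / 2 by lra.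
  have [w hw xw] := hx _ e2; have [u zu wu] := hw _ e2; exists u => //.
  by have := dist_triangle hd w x u; lra.
- move=> x hx; rewrite /cball /=; apply/ler_addgt0Pr => e e0.
  have [w /= /zT hw xw] := hx _ e0.
  by have := dist_triangle hd w x0 x; rewrite (distC hd w x); lra.
Qed.

Let mD s : measurable_fun setT (fun y => D y `^ s).
Proof.
apply: (measurableT_comp (measurable_powR _)).
by apply: (measurable_lip hd hB); exists 1 => y z; rewrite mul1r.
Qed.

Let mv : measurable_fun setT v.
Proof. exact: (measurable_test_fun hd hB _ z01 zlip m00 Dm Dlip a0 a1 r0). Qed.

Let mg : measurable_fun setT g.
Proof. exact: (measurable_test_grad hd hB _ zlip m00 Dm Dlip mgz a0 a1 r0). Qed.

Let mV : measurable_fun setT V.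
Proof. by apply: measurable_funM => //; exact: (measurableT_comp (measurable_powR _)). Qed.

Let mO : measurable Omega. Proof. exact: (dopen_measurable hB). Qed.

(** Finiteness allows the absorbed term to be subtracted later. The integrand lives on a ball, the
    weight is at most r^(-a), and D^(beta - p) is at most m0^(beta - p) because [beta < p]. *)
Let V_fin : (\int[mu]_(x in Omega) (V x)%:E < +oo)%E.
Proof.
pose M := (r `^ (- a)) `^ p * m0 `^ (beta - p).
have M0 : 0 <= M by rewrite mulr_ge0 ?powR_ge0.
have mB := measurable_cball hd hB x0 T.
apply: le_lt_trans (_ : (\int[mu]_(x in Omega) (M%:E * (\1_(cball d x0 T) x)%:E) < +oo)%E); last first.
  rewrite ge0_integralZl_EFin //; last by apply/measurable_EFinP/measurable_funTS; exact: measurable_indic.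
  rewrite integral_indic //.
  have : (mu (cball d x0 T `&` Omega) <= mu (cball d x0 T))%E.
    by apply: mu_le => //; exact: measurableI.
  rewrite (cball_fineK hfin) // => h.
  apply: le_lt_trans (_ : (M%:E * (fine (mu (cball d x0 T)))%:E < +oo)%E).
    by apply: lee_wpmul2l; rewrite ?lee_fin.
  by rewrite -EFinM ltry.
apply: ge0_le_integral => //.
- by move=> x _; rewrite lee_fin.
- by apply/measurable_EFinP/measurable_funTS.
- apply: measurable_funTS; apply/measurable_EFinP; apply: measurable_funM => //.
  all: try exact: measurable_indic.
move=> x _; rewrite -EFinM lee_fin indicE.
have [zx|zx] := eqVneq (zeta x) 0.
  by rewrite /V /v /test_fun zx expr0n mul0r powR0 // mul0r mulr_ge0.
have -> : (x \in cball d x0 T) = true by apply/mem_set; exact: zT.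
rewrite mulr1.
apply: ler_pM; rewrite ?powR_ge0 //.
  apply: ge0_ler_powR; rewrite ?nnegrE ?powR_ge0 //.
  apply: le_trans (bump_weight_le a0 r0 (D0 x)).
  rewrite /v /test_fun ler_piMl ?(ltW (W0 x)) //.
  exact: exprn_ile1.
rewrite -(opprB p) !powRN lef_pV2 ?posrE ?powR_gt0 //.
by apply: ge0_ler_powR; rewrite ?nnegrE ?(ltW m00) ?(ltW (D0 x)) ?subr_ge0 ?(ltW bp).
Qed.

(** Where [zeta] is positive, the gradient integrand either falls under the absorption case, with a
    factor whose product with [CH] is at most 1/2, or is bounded by [H]. Moving half of the left
    integral across costs the factor 2. *)
Lemma hardy_test_fun :
  (\int[mu]_(y in Omega) (test_fun zeta D a r n y `^ p * D y `^ (beta - p))%:E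
    <= (2 * CH)%:E * \int[mu]_(y in Omega) (H y)%:E)%E.
Proof.
have [CH0 hh] := hardy.
rewrite -/v -[X in (X <= _)%E]/(\int[mu]_(y in Omega) (V y)%:E)%E.
have J0 : (0 <= \int[mu]_(y in Omega) (H y)%:E)%E.
  by apply: integral_ge0 => y _; rewrite lee_fin.
have I0 : (0 <= \int[mu]_(y in Omega) (V y)%:E)%E.
  by apply: integral_ge0 => y _; rewrite lee_fin.
(* If [zeta] vanishes identically the left side is 0; the case is separate because compactness of
   the support was proved for nonempty sets. *)
have [hz|hz] := pselect (exists y, zeta y != 0); last first.
  rewrite (eq_integral (fun=> 0%E)); last first.
    move=> y _; have zy : zeta y = 0 by apply/eqP; apply: contrapT => h; apply: hz; exists y; apply/negP.
    by rewrite /V /v /test_fun zy expr0n mul0r powR0 // mul0r.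
  by rewrite integral0 mule_ge0 // lee_fin mulr_ge0 // ltW.
have := hh v (EFin \o g).
move=> /(_ (test_fun_lipschitz _ z01 zlip m00 Dm Dlip a0 a1 r0) (compact_supp hz)
  (test_grad_upper hd hB z01 zlip m00 Dm Dlip g0 mgz zloc a0 a1 r0 n0)).
(* [D] is known to be the distance to the complement only where [zeta] is nonzero; elsewhere both
   integrands vanish. *)
rewrite (eq_integral (fun y => (V y)%:E)); last first.
  move=> y _; have [zy|zy] := eqVneq (zeta y) 0.
    have -> : v y = 0 by rewrite /v /test_fun zy expr0n mul0r.
    by rewrite /V /v /test_fun zy expr0n mul0r powR0 // mul0r normr0 poweR_EFin powR0 // mul0e.
  by rewrite zD // !poweR_EFin -EFinM ger0_norm.
rewrite [X in (_ <= _ * X)%E -> _](eq_integral (fun y => (g y `^ p * D y `^ beta)%:E)); last first.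
  move=> y _; have [zy|zy] := eqVneq (zeta y) 0.
    have -> : (EFin \o g) y = 0%E.
      by rewrite /= /g /test_grad zy expr0n -(prednK n0) /= mulr0 !mul0r.
    have -> : g y = 0 by rewrite /= /g /test_grad zy expr0n -(prednK n0) /= mulr0 !mul0r.
    by rewrite poweR_EFin powR0 // mul0e mul0r.
  by rewrite zD // !poweR_EFin -EFinM.
have := kCH; set th := (4 * (n.+1%:R * k + a)) `^ p => kCH'.
have th0 : 0 <= th by exact: powR_ge0.
have hle : (\int[mu]_(y in Omega) (g y `^ p * D y `^ beta)%:E <=
   th%:E * \int[mu]_(y in Omega) (V y)%:E + \int[mu]_(y in Omega) (H y)%:E)%E.
  rewrite -ge0_integralZl_EFin //; last 2 first.
  - by move=> y _; rewrite lee_fin.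
  - by apply/measurable_EFinP/measurable_funTS.
  rewrite -ge0_integralD //; last 4 first.
  - by move=> y _; rewrite -EFinM lee_fin mulr_ge0.
  - by apply: measurable_funTS; apply/measurable_EFinP; exact: measurable_funM.
  - by move=> y _; rewrite lee_fin.
  - by apply/measurable_EFinP/measurable_funTS.
  apply: ge0_le_integral => //.
  - by move=> y _; rewrite lee_fin mulr_ge0 ?powR_ge0.
  - apply/measurable_EFinP/measurable_funTS; apply: measurable_funM => //.
    exact: (measurableT_comp (measurable_powR _)).
  - apply: measurable_funTS; apply/measurable_EFinP; apply: measurable_funD => //.
    exact: measurable_funM.
  move=> y _; rewrite -EFinM -EFinD lee_fin.
  have [zy|zy] := eqVneq (zeta y) 0.
    have -> : g y = 0 by rewrite /= /g /test_grad zy expr0n -(prednK n0) /= mulr0 !mul0r.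
    by rewrite powR0 // mul0r addr_ge0 // mulr_ge0.
  have zy0 : 0 < zeta y by rewrite lt_neqAle eq_sym zy z0.
  case: (leP (gz y * D y) (k * zeta y)) => h.
    apply: le_trans (_ : th * V y <= _); last by rewrite lerDl.
    by apply: gradient_absorb => //; exact: ltW.
  by apply: le_trans (gH zy0 h) _; rewrite lerDr mulr_ge0.
move=> /le_trans /(_ (lee_wpmul2l _ hle)); rewrite lee_fin => /(_ (ltW CH0)).
move: I0 J0 V_fin {hle}.
case: (\int[mu]_(y in Omega) (V y)%:E)%E => [I|//|//].
case: (\int[mu]_(y in Omega) (H y)%:E)%E => [J|_ _ _ _|//]; last first.
  by rewrite gt0_muley ?leey // lte_fin mulr_gt0.
have -> : (CH%:E * (th%:E * I%:E + J%:E) = (CH * (th * I + J))%:E)%E by [].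
have -> : ((2 * CH)%:E * J%:E = (2 * CH * J)%:E)%E by [].
rewrite !lee_fin => I0 J0 _ h.
have : th * CH * I <= 2^-1 * I by rewrite ler_wpM2r.
by move: h; rewrite mulrDr mulrA (mulrC CH th); lra.
Qed.

End HardyTest.

(** * Cutoff functions *)

Section Cutoffs.
Context {R : realType} {dX : measure_display} {X : measurableType dX}.
Variables (d : X -> X -> R) (hd : is_metric d) (hB : borel_sigma d).

(* [g] bounds the local Lipschitz constant of [zeta], in a lower semicontinuous way. *)
Definition cutoff (zeta g : X -> R) : Prop :=
  [/\ forall y, 0 <= zeta y <= 1,
      exists L, forall y z, `|zeta y - zeta z| <= L * d y z,
      forall y, 0 <= g y,
      measurable_fun setT g &
      forall y, exists2 rho, 0 < rho & exists2 A, 0 <= A &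
        forall z, d y z < rho -> `|zeta y - zeta z| <= A * d y z /\ A <= g z].

Lemma dist_min_le (a b a' b' : R) :
  `|Num.min a b - Num.min a' b'| <= Num.max `|a - a'| `|b - b'|.
Proof.
have : `|a - a'| <= Num.max `|a - a'| `|b - b'| by rewrite le_max lexx.
have : `|b - b'| <= Num.max `|a - a'| `|b - b'| by rewrite le_max lexx orbT.
move: (Num.max _ _) => M; rewrite !ler_norml => /andP[? ?] /andP[? ?].
by case: (leP a b) => h1; case: (leP a' b') => h2; apply/andP; split; lra.
Qed.

Lemma cutoff_min z1 g1 z2 g2 : cutoff z1 g1 -> cutoff z2 g2 ->
  cutoff (fun y => Num.min (z1 y) (z2 y)) (fun y => Num.max (g1 y) (g2 y)).
Proof.
move=> [h1 [L1 l1] p1 m1 c1] [h2 [L2 l2] p2 m2 c2]; split.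
- move=> y; have /andP[a1 b1] := h1 y; have /andP[a2 b2] := h2 y.
  by rewrite le_min a1 a2 ge_min b1.
- exists (Num.max L1 L2) => y z; apply: le_trans (dist_min_le _ _ _ _) _.
  rewrite ge_max; have dd := dist_ge0 hd y z; apply/andP; split.
    by apply: le_trans (l1 _ _) _; rewrite ler_wpM2r // le_max lexx.
  by apply: le_trans (l2 _ _) _; rewrite ler_wpM2r // le_max lexx orbT.
- by move=> y; rewrite le_max p1.
- exact: measurable_maxr.
- move=> y; have [r1 r10 [A1 A10 k1]] := c1 y; have [r2 r20 [A2 A20 k2]] := c2 y.
  exists (Num.min r1 r2); first by rewrite lt_min r10.
  exists (Num.max A1 A2); first by rewrite le_max A10.
  move=> z; rewrite lt_min => /andP[yz1 yz2].
  have [e1 f1] := k1 z yz1; have [e2 f2] := k2 z yz2; split.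
    apply: le_trans (dist_min_le _ _ _ _) _.
    rewrite ge_max; have dd := dist_ge0 hd y z; apply/andP; split.
      by apply: le_trans e1 _; rewrite ler_wpM2r // le_max lexx.
    by apply: le_trans e2 _; rewrite ler_wpM2r // le_max lexx orbT.
  by rewrite ge_max !le_max f1 f2 orbT.
Qed.

(** Openness of [U] makes the bound [L] available on a whole neighbourhood of each of its points;
    around the other points [phi] is constant and the slope 0 works. *)
Lemma cutoff_basic (phi : X -> R) (L : R) (U : set X) : 0 <= L -> dopen d U ->
  (forall y, 0 <= phi y <= 1) -> (forall y z, `|phi y - phi z| <= L * d y z) ->
  (forall y, ~ U y -> exists2 rho, 0 < rho & forall z, d y z < rho -> phi y = phi z) ->
  cutoff phi (fun y => L * \1_U y).
Proof.
move=> L0 oU h1 hL hU.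
have mU := dopen_measurable hB oU.
split => //; first by exists L.
- by move=> y; rewrite mulr_ge0 // indicE; case: (_ \in _).
- by apply: measurable_funM => //; exact: measurable_indic.
move=> y; have [Uy|nUy] := pselect (U y).
  have [rho [rho0 hrho]] := oU y Uy; exists rho => //; exists L => // z yz; split => //.
  by rewrite indicE mem_set ?mulr1 //; exact: hrho.
have [rho rho0 hrho] := hU y nUy; exists rho => //; exists 0 => // z yz; split.
  by rewrite (hrho z yz) subrr normr0 mul0r.
by rewrite mulr_ge0 // indicE; case: (_ \in _).
Qed.

Definition clamp (t : R) := Num.min 1 (Num.max 0 t).

Lemma clamp01 t : 0 <= clamp t <= 1.
Proof. by rewrite /clamp le_min ge_min le_max !lexx ler01. Qed.

Lemma clamp_le0 t : t <= 0 -> clamp t = 0.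
Proof. by move=> t0; rewrite /clamp (max_l t0) min_r. Qed.

Lemma clamp_ge1 t : 1 <= t -> clamp t = 1.
Proof. by move=> t1; rewrite /clamp min_l // le_max t1 orbT. Qed.

Lemma clamp_lip s t : `|clamp s - clamp t| <= `|s - t|.
Proof.
have key u w : u <= w -> `|clamp u - clamp w| <= w - u.
  move=> uw; rewrite /clamp ler_norml.
  case: (leP 0 u) => h1; case: (leP 0 w) => h2; try lra;
  repeat (match goal with |- context [Num.min ?a ?b] => case: (leP a b) => ? end); lra.
case: (leP s t) => h; first by rewrite [leRHS]distrC (@ger0_norm _ (t - s)) ?subr_ge0 //; exact: key.
by rewrite distrC (@ger0_norm _ (s - t)) ?subr_ge0 ?(ltW h) //; apply: key; exact: ltW.
Qed.

(** The function is 0 up to distance [2 * r] from [c] and 1 from [3 * r] on; the margin up to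
    [4 * r] makes it locally constant off the open ball. *)
Lemma hole_cutoff c (r : R) : 0 < r ->
  cutoff (fun y => clamp (d c y / r - 2)) (fun y => r^-1 * \1_([set y | d c y < 4 * r]) y).
Proof.
move=> r0; apply: cutoff_basic.
- by rewrite invr_ge0 ltW.
- exact: dopen_ball.
- by move=> y; exact: clamp01.
- move=> y z; apply: le_trans (clamp_lip _ _) _.
  have -> : d c y / r - 2 - (d c z / r - 2) = r^-1 * (d c y - d c z) by field; rewrite gt_eqF.
  by rewrite normrM gtr0_norm ?invr_gt0 // ler_wpM2l ?invr_ge0 ?(ltW r0) // dist_lip.
move=> y /negP; rewrite -leNgt => cy; exists r => // z yz.
have h t : 3 * r <= t -> 1 <= t / r - 2.
  by move=> ht; rewrite lerBrDr ler_pdivlMr //; lra.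
rewrite !clamp_ge1 //; apply: h; last by lra.
by have := dist_triangle hd z c y; rewrite (distC hd z y); lra.
Qed.

(** The value is 1 while neither distance exceeds its radius by more than [Rb / 8], and 0 once one
    excess reaches [Rb / 4]. The condition on [x0] keeps the support near B_0, so that the cover of
    the complement in 2B_0 controls the distance to the whole complement. *)
Lemma outer_cutoff x x0 (r0 Rb : R) : 0 < Rb ->
  cutoff (fun y => clamp (2 - 8 / Rb * Num.max (d x y - Rb) (d x0 y - r0)))
    (fun y => 8 / Rb * \1_([set y | d x y < 2 * Rb]) y).
Proof.
move=> R0; have L0 : 0 < 8 / Rb by rewrite divr_gt0.
apply: cutoff_basic.
- exact: ltW.
- exact: dopen_ball.
- by move=> y; exact: clamp01.
- move=> y z; apply: le_trans (clamp_lip _ _) _.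
  set P := Num.max _ _; set Q := Num.max _ _.
  have -> : 2 - 8 / Rb * P - (2 - 8 / Rb * Q) = 8 / Rb * (Q - P) by ring.
  rewrite normrM (gtr0_norm L0) ler_wpM2l ?(ltW L0) // /P /Q.
  have := dist_lip hd x y z; have := dist_lip hd x0 y z.
  rewrite !ler_norml => /andP[? ?] /andP[? ?].
  by case: (leP (d x y - Rb) _); case: (leP (d x z - Rb) _); lra.
move=> y /negP; rewrite -leNgt => xy; exists (Rb / 2); first by lra.
move=> z yz.
have h t u : Rb / 2 <= t -> 2 - 8 / Rb * Num.max t u <= 0.
  move=> ht; rewrite subr_le0; apply: le_trans (_ : 8 / Rb * (Rb / 2) <= _).
    have -> : 8 / Rb * (Rb / 2) = 4 by field; rewrite gt_eqF.
    by rewrite ler_nat.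
  by rewrite ler_wpM2l ?(ltW L0) // le_max ht.
rewrite !clamp_le0 //; apply: h; last by lra.
by have := dist_triangle hd z x y; rewrite (distC hd z y); lra.
Qed.

(** The hole cutoffs are combined by minima, not products: the gradient bound is then a maximum, so
    at each point it comes from [g0] or from a single hole, however much the balls overlap. *)
Lemma cover_cutoff (l : seq nat) (c : nat -> X) (r : nat -> R) z0 g0 :
  (forall k, k \in l -> 0 < r k) -> cutoff z0 g0 ->
  exists zeta g : X -> R,
  [/\ cutoff zeta g, forall y, zeta y <= z0 y,
      forall y k, k \in l -> 0 < zeta y -> 2 * r k < d (c k) y,
      forall y, (forall k, k \in l -> 4 * r k <= d (c k) y) -> zeta y = z0 y &
      forall y, g y = g0 y \/ exists2 k, k \in l & d (c k) y < 4 * r k /\ g y = (r k)^-1].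
Proof.
move=> + h0; elim: l => [|k l IH] hr.
  by exists z0, g0; split => // y; left.
have [|zeta [g [hz zle zpos zeq hg]]] := IH.
  by move=> j jl; apply: hr; rewrite inE jl orbT.
have rk : 0 < r k by apply: hr; rewrite inE eqxx.
pose eta y := clamp (d (c k) y / r k - 2).
pose h y : R := (r k)^-1 * \1_([set y | d (c k) y < 4 * r k]) y.
exists (fun y => Num.min (zeta y) (eta y)), (fun y => Num.max (g y) (h y)).
have [z01 _ g00 _ _] := hz.
split.
- by apply: cutoff_min => //; exact: hole_cutoff.
- by move=> y; rewrite ge_min zle.
- move=> y j; rewrite inE lt_min => /orP[/eqP ->|jl] /andP[zy ey]; last exact: zpos.
  rewrite ltNge; apply/negP => cy; move: ey.
  by rewrite /eta clamp_le0 ?ltxx // subr_le0 ler_pdivrMr.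
- move=> y hy.
  have -> : eta y = 1.
    rewrite /eta clamp_ge1 // lerBrDr ler_pdivlMr //.
    by have := hy k; rewrite inE eqxx => /(_ isT); lra.
  rewrite min_l; last by case/andP: (z01 y).
  by apply: zeq => j jl; apply: hy; rewrite inE jl orbT.
- move=> y; rewrite /h indicE; case: (boolP (y \in _)) => hy; last first.
    rewrite mulr0 max_l //; case: (hg y) => [->|[j jl jj]]; first by left.
    by right; exists j => //; rewrite inE jl orbT.
  rewrite mulr1; case: (leP (g y) _) => _.
    right; exists k; first by rewrite inE eqxx.
    by move: hy; rewrite inE.
  case: (hg y) => [->|[j jl jj]]; first by left.
  by right; exists j => //; rewrite inE jl orbT.
Qed.

Lemma seq_radius_lb (l : seq nat) (r : nat -> R) : (forall k, k \in l -> 0 < r k) ->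
  exists2 m, 0 < m & forall k, k \in l -> m <= r k.
Proof.
elim: l => [|k l IH] hr; first by exists 1.
have [|m m0 hm] := IH; first by move=> j jl; apply: hr; rewrite inE jl orbT.
exists (Num.min m (r k)); first by rewrite lt_min m0 hr // inE eqxx.
by move=> j; rewrite inE ge_min => /orP[/eqP ->|/hm ->//]; rewrite lexx orbT.
Qed.

End Cutoffs.

(** * Decay of the neighbourhoods of the complement *)

Lemma dist_max_le (R : realType) (a b m : R) : `|Num.max a m - Num.max b m| <= `|a - b|.
Proof.
move: (lexx `|a - b|); rewrite ler_norml ler_norml => /andP[? ?].
have := normr_ge0 (a - b) => ?.
by case: (leP a m) => ?; case: (leP b m) => ?; apply/andP; split; lra.
Qed.

Lemma measurable_nbhd_set (R : realType) (dX : measure_display) (X : measurableType dX)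
  (d : X -> X -> R) (E : set X) (r : R) : is_metric d -> borel_sigma d -> E !=set0 ->
  measurable (nbhd_set d E r).
Proof.
move=> hd hB E0; have [D [hE _ _ _ lE]] := edist_fun hd E0.
apply: (dopen_measurable hB).
have -> : nbhd_set d E r = [set y | - r < - D y].
  by apply/seteqP; split=> y; rewrite /nbhd_set /= hE lte_fin ltrN2.
by apply: (@lip_dopen_gt _ _ _ hd _ 1) => y w; rewrite -opprD normrN mul1r.
Qed.

(** * Finite covers and simple functions *)

Section StepFunctions.
Context {R : realType} {dX : measure_display} {X : measurableType dX}.
Variable (mu : {measure set X -> \bar R}).

Lemma measure_cover_seq (P A : set X) (l : seq nat) (U : nat -> set X) :
  measurable P -> measurable A -> (forall k, measurable (U k)) ->
  (forall y, P y -> A y \/ exists2 k, k \in l & U k y) ->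
  (mu P <= mu A + \sum_(k <- l) mu (U k))%E.
Proof.
move=> mP + mU; elim: l A => [|k l IH] A mA hP.
  by rewrite big_nil adde0; apply: mu_le => // y /hP [//|[k]].
rewrite big_cons addeA; apply: le_trans (IH (A `|` U k) _ _) _.
- exact: measurableU.
- move=> y /hP [Ay|[j]]; first by left; left.
  rewrite inE => /orP[/eqP -> Uy|jl Uy]; first by left; right.
  by right; exists j.
by apply: leeD => //; exact: measureU2.
Qed.

(** The majorant of the residual terms: [U0] will carry the gradient of the outer cutoff, and [U k]
    that of the hole at the k-th covering ball. *)
Definition step_fun (h0 : R) (U0 : set X) (l : seq nat) (h : nat -> R) (U : nat -> set X) y : R :=
  h0 * \1_U0 y + \sum_(k <- l) h k * \1_(U k) y.

Variables (h0 : R) (U0 : set X) (h : nat -> R) (U : nat -> set X) (O : set X).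
Hypotheses (h00 : 0 <= h0) (mU0 : measurable U0) (hk0 : forall k, 0 <= h k)
  (mU : forall k, measurable (U k)) (mO : measurable O).

Lemma step_fun_ge0 l y : 0 <= step_fun h0 U0 l h U y.
Proof.
have i0 (B : set X) : 0 <= \1_B y :> R by rewrite indicE; case: (_ \in _).
by rewrite addr_ge0 ?mulr_ge0 // sumr_ge0 // => k _; rewrite mulr_ge0.
Qed.

Lemma step_fun_ge0_term l y : U0 y -> h0 <= step_fun h0 U0 l h U y.
Proof.
move=> Uy; rewrite /step_fun indicE mem_set // mulr1 lerDl sumr_ge0 // => k _.
by rewrite mulr_ge0 // indicE; case: (_ \in _).
Qed.

Lemma step_fun_ge_term l y k : k \in l -> U k y -> h k <= step_fun h0 U0 l h U y.
Proof.
have i0 (B : set X) : 0 <= \1_B y :> R by rewrite indicE; case: (_ \in _).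
move=> kl Uy; rewrite /step_fun.
apply: le_trans (_ : \sum_(j <- l) h j * \1_(U j) y <= _); last first.
  by rewrite lerDr mulr_ge0.
elim: l kl => // j l IH; rewrite inE big_cons => /orP[/eqP <-|/IH /le_trans]; last first.
  by apply; rewrite lerDr mulr_ge0.
rewrite indicE mem_set // mulr1 lerDl sumr_ge0 // => i _.
by rewrite mulr_ge0.
Qed.

Lemma measurable_step_fun l : measurable_fun setT (step_fun h0 U0 l h U).
Proof.
apply: measurable_funD; first by apply: measurable_funM => //; exact: measurable_indic.
by apply: measurable_sum => k; apply: measurable_funM => //; exact: measurable_indic.
Qed.

Lemma integral_step_fun l :
  (\int[mu]_(y in O) (step_fun h0 U0 l h U y)%:E <=
   h0%:E * mu U0 + \sum_(k <- l) (h k)%:E * mu (U k))%E.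
Proof.
have term (c : R) B : 0 <= c -> measurable B ->
    (\int[mu]_(y in O) (c * \1_B y)%:E <= c%:E * mu B)%E.
  move=> c0 mB; under eq_integral do rewrite EFinM.
  rewrite ge0_integralZl_EFin //; last by apply/measurable_EFinP/measurable_funTS; exact: measurable_indic.
  rewrite integral_indic //; apply: lee_wpmul2l; first by rewrite lee_fin.
  by apply: mu_le => //; exact: measurableI.
elim: l => [|k l IH].
  rewrite big_nil adde0; apply: le_trans (term _ _ h00 mU0).
  by under eq_integral do rewrite /step_fun big_nil addr0.
have -> : (fun y => (step_fun h0 U0 (k :: l) h U y)%:E) =
    (fun y => ((h k * \1_(U k) y)%:E + (step_fun h0 U0 l h U y)%:E)%E).
  by apply/funext => y; rewrite -EFinD /step_fun big_cons addrCA.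
rewrite ge0_integralD //; last 4 first.
- by move=> y _; rewrite lee_fin mulr_ge0 // indicE; case: (_ \in _).
- apply/measurable_EFinP/measurable_funTS; apply: measurable_funM => //; exact: measurable_indic.
- by move=> y _; rewrite lee_fin step_fun_ge0.
- by apply/measurable_EFinP/measurable_funTS; exact: measurable_step_fun.
rewrite big_cons [leRHS]addeCA; apply: leeD; [exact: (term _ _ (hk0 k) (mU k))|exact: IH].
Qed.

End StepFunctions.

(** * From zero content in 2B_0 to decay of neighbourhoods in B_0 *)

Section KeyEstimate.
Context {R : realType} {dX : measure_display} {X : measurableType dX}.
Variables (d : X -> X -> R) (mu : {measure set X -> \bar R}) (Cd : R).
Hypotheses (hd : is_metric d) (hB : borel_sigma d) (hcomp : dcomplete d).
Hypotheses (hfin : balls_pos_finite d mu) (hdoub : doubling_with d mu Cd).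
Variables (Omega : set X) (p beta CH : R).
Hypotheses (oO : dopen d Omega) (hardy : hardy_ineq d mu Omega p beta CH).
Hypotheses (p1 : 1 <= p) (bp : beta < p).
Variables (a k : R) (n : nat).
Hypotheses (a0 : 0 < a) (a1 : a < 1) (k0 : 0 < k) (k1 : k <= 1) (n0 : (0 < n)%N)
  (kCH : (4 * (n.+1%:R * k + a)) `^ p * CH <= 2^-1)
  (apq : a * p < p - beta) (bn : `|beta| + a * p <= n%:R).

Let q := p - beta.
Let de := a * p.
(** The constants of [gradient_residual] with [N = 16]: [C1] for s = -de and M = 1, at the outer
    cutoff, and [C2 r] for s = de and M = r^(-2 de), at the holes. *)
Let C1 := (4 * (n.+1%:R + a / k)) `^ p * (16 / k) `^ `|beta - de|.
Let C2 r := (4 * (n.+1%:R + a / k)) `^ p * (16 / k) `^ `|beta + de| * r `^ (- (2 * de)).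

(** The factor [2 * CH] comes from the absorbed Hardy inequality, 8^(q + de) from the slope [8 / Rb]
    of the outer cutoff, and [Cd] from the ball of radius [2 * Rb] that carries it. *)
Definition hardy_codim_cst := 2 * CH * (C1 * 8 `^ (q + de) * Cd).

(** The cover depends on [tau], but it enters the bound only through its weighted sum, so the factor
    of [tau] in the last term is fixed once [r] is. *)
Lemma hardy_content_estimate x0 r0 s x r Rb tau : 0 < r0 ->
  q - de <= s -> haus_content d mu s 1 (cball d x0 (2 * r0) `&` ~` Omega) = 0%E ->
  (cball d x0 r0 `&` ~` Omega) x -> 0 < r -> r <= Rb / 8 -> Rb < 2 * r0 -> 0 < tau ->
  (mu (nbhd_set d (cball d x0 r0 `&` ~` Omega) r `&` cball d x Rb) <=
   (hardy_codim_cst * (r / Rb) `^ (q + de))%:E * mu (cball d x Rb) +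
   ((r `^ (q + de) * (2 * CH * C2 r) + 1) * Cd ^+ 2 * tau)%:E)%E.
Proof.
move=> r00 qs cont0 Ex r_0 rR Rr0 tau0.
set E := cball d x0 r0 `&` ~` Omega in Ex *.
set F := cball d x0 (2 * r0) `&` ~` Omega in cont0 *.
have R0 : 0 < Rb by lra.
have p0 : 0 < p := lt_le_trans ltr01 p1.
have de0 : 0 < de by rewrite mulr_gt0.
have qde : 0 < q - de by rewrite subr_gt0.
have Cd0 : 0 < Cd := doubling_gt0 hfin hdoub x.
have CH0 : 0 < CH by case: hardy.
have C10 : 0 <= C1 by rewrite mulr_ge0 ?powR_ge0.
have C20 : 0 <= C2 r by rewrite !mulr_ge0 ?powR_ge0.
have EF : E `<=` F by move=> y [h1 h2]; split => //; move: h1; rewrite /cball /=; lra.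
have cF : dcompact d F.
  apply: (closed_bounded_dcompact hd hB hfin hdoub hcomp (x0 := x0) (T := 2 * r0)).
  - by lra.
  - by exists x; exact: EF.
  - move=> y hy; split.
      rewrite /cball /=; apply/ler_addgt0Pr => e e0.
      have [w [+ _] yw] := hy e e0; rewrite /cball /= => hw.
      by have := dist_triangle hd w x0 y; rewrite (distC hd w y); lra.
    move=> /oO [e [e0 he]]; have [w [_ nw] yw] := hy e e0.
    by apply: nw; exact: he.
  - by move=> y [].
have [l [c [rk [hrk hmeet hcov hsum]]]] := haus_content_finite_cover hd cF qs cont0 tau0.
have rk0 j : j \in l -> 0 < rk j by move=> /hrk /andP[].
have [z [g [hz zle zpos zeq hg]]] := cover_cutoff hd hB c rk0 (outer_cutoff hd hB x x0 r0 R0).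
have [dO [dOE dO0 dOub dOlb dOlip]] : exists D : X -> R,
  [/\ forall x, Defs.edist d x (~` Omega) = (D x)%:E, forall x, 0 <= D x,
      forall x y, (~` Omega) y -> D x <= d x y,
      forall x t, (forall y, (~` Omega) y -> t <= d x y) -> t <= D x &
      forall x y, `|D x - D y| <= d x y].
  by apply: edist_fun => //; exists x; case: Ex.
have [mr mr0 hmr] := seq_radius_lb rk0.
have psi_supp y : 0 < z y -> d x y < 2 * Rb /\ d x0 y < r0 + Rb / 4.
  move=> zy; have := lt_le_trans zy (zle y).
  set t := Num.max (d x y - Rb) (d x0 y - r0) => h.
  have ht : t < Rb / 4.
    rewrite ltNge; apply/negP => ht; move: h.
    rewrite clamp_le0 ?ltxx // subr_le0; apply: le_trans (_ : 8 / Rb * (Rb / 4) <= _).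
      by have -> : 8 / Rb * (Rb / 4) = 2 by field; rewrite gt_eqF.
    by rewrite ler_wpM2l // divr_ge0 // ltW.
  have h1 : d x y - Rb <= t by rewrite /t le_max lexx.
  have h2 : d x0 y - r0 <= t by rewrite /t le_max lexx orbT.
  by split; lra.
(* A point of the complement in 2B_0 lies in the 3/2 enlargement of a covering ball whose double is
   avoided by the support of [z], leaving half a radius. A point outside 2B_0 is at least [r0 / 2]
   away, because the support stays within r0 + Rb/4 < 3 r0/2 of [x0]. *)
pose m0 := Num.min (r0 / 2) (mr / 2).
have m00 : 0 < m0 by rewrite lt_min; apply/andP; split; lra.
have zm y : 0 < z y -> m0 <= dO y.
  move=> zy; have [_ h2] := psi_supp y zy; apply: dOlb => w nOw.
  have [hw|hw] := leP (d x0 w) (2 * r0).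
    have [j jl cj] := hcov w (conj hw nOw).
    rewrite /m0 ge_min; apply/orP; right.
    have := zpos y j jl zy; have := hmr j jl; have := dist_triangle hd w (c j) y.
    by rewrite (distC hd w y); lra.
  rewrite /m0 ge_min; apply/orP; left.
  by have := dist_triangle hd y x0 w; lra.
(* The truncation makes [D] bounded below everywhere and leaves it unchanged where [z] is
   positive. *)
pose D y := Num.max (dO y) m0.
have Dm y : m0 <= D y by rewrite le_max lexx orbT.
have DE y : 0 < z y -> D y = dO y by move=> zy; rewrite /D max_l // zm.
have Dlip y w : `|D y - D w| <= d y w.
  exact: le_trans (dist_max_le _ _ _) (dOlip y w).
have [z01 [Lz zlip] g0 mg zloc] := hz.
have zgt y : z y != 0 -> 0 < z y by move=> h; rewrite lt_neqAle eq_sym h; case/andP: (z01 y).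
pose U0 := [set y | d x y < 2 * Rb].
pose U j := [set y | d (c j) y < 4 * rk j].
have mU0 : measurable U0 by exact: measurable_ballo.
have mU j : measurable (U j) by exact: measurable_ballo.
pose h0 := C1 * (8 / Rb) `^ (q + de).
pose h j := C2 r * (rk j) `^ (- (q - de)).
have h00 : 0 <= h0 by rewrite mulr_ge0 // powR_ge0.
have hj0 j : 0 <= h j by rewrite mulr_ge0 // powR_ge0.
have mO : measurable Omega by exact: (dopen_measurable hB).
have hbn e : `|e| <= de -> - (beta + e) <= n%:R.
  move=> he; apply: le_trans bn; have := ler_norm (- beta); have := ler_norm (- e).
  by rewrite !normrN -/de; lra.
have D0 y : 0 < D y by exact: lt_le_trans (Dm y).
have W0 y : 0 <= bump_weight a r (D y) by apply/ltW/bump_weight_gt0.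
have Hpt y : 0 < z y -> k * z y < g y * D y ->
    test_grad z D g a r n y `^ p * D y `^ beta <= step_fun h0 U0 l h U y.
  move=> zy kgz; have [_ z1] := andP (z01 y).
  have [W1 W2] := bump_weight_powR a r_0 (D0 y) (ltW p0).
  have [xy _] := psi_supp y zy.
  have gy0 : 0 < g y.
    rewrite -(pmulr_lgt0 _ (D0 y)); apply: le_lt_trans kgz.
    by rewrite mulr_ge0 ?(ltW k0) ?(ltW zy).
  case: (hg y) => [gE|[j jl [cy gE]]].
    (* Gradient of the outer cutoff: the centre [x] is in the complement, so [D y] is below [2 * Rb]
       and [g y * D y] at most 16. The bound W^p <= D^(-de) applies. *)
    have gE' : g y = 8 / Rb by rewrite gE indicE mem_set // mulr1.
    apply: le_trans (_ : h0 <= _); last exact: step_fun_ge0_term.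
    apply: le_trans (gradient_residual (s := - de) (M := 1) (N := 16) p1 (D0 y) zy z1 (W0 y) (ltW a0) k0 k1 gy0 _ _ _ (ltW kgz) _ _) _ => //.
    - by rewrite ler1n.
    - by rewrite mul1r.
    - rewrite gE' (DE y zy); have : dO y <= d x y by rewrite (distC hd); apply: dOub; case: Ex.
      move=> hdo; apply: le_trans (_ : 8 / Rb * (2 * Rb) <= _).
        by rewrite ler_wpM2l ?divr_ge0 ?(ltW R0) //; lra.
      by have -> : 8 / Rb * (2 * Rb) = 16 by field; rewrite gt_eqF.
    - by apply: hbn; rewrite normrN gtr0_norm.
    by rewrite mulr1 gE' /h0 /C1 (_ : p - (beta - de) = q + de) // /q; ring.
  (* Gradient of a hole: the ball meets the complement within [rk j] of its centre and [y] is within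
     [4 * rk j], so [g y * D y] is below 5. Here W^p <= r^(-2 de) D^de is used. *)
  apply: le_trans (_ : h j <= _); last exact: step_fun_ge_term.
  have rj := rk0 j jl.
  apply: le_trans (gradient_residual (s := de) (M := r `^ (- (2 * de))) (N := 16) p1 (D0 y) zy z1 (W0 y) (ltW a0) k0 k1 gy0 _ _ _ (ltW kgz) _ _) _ => //.
  - by rewrite ler1n.
  - exact: powR_ge0.
  - rewrite gE (DE y zy) mulrC ler_pdivrMr //.
    have [w [_ nOw] cw] := hmeet j jl.
    have := dOub y w nOw; have := dist_triangle hd (c j) y w; rewrite (distC hd y (c j)).
    by move: cy; lra.
  - by apply: hbn; rewrite gtr0_norm.
  rewrite gE /h /C2 -powR_inv1 ?(ltW rj) // -powRrM.
  by rewrite (_ : -1 * (p - (beta + de)) = - (q - de)) // /q; ring.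
have zD y : z y != 0 -> dist_compl d Omega y = (D y)%:E.
  by move=> /zgt zy; rewrite /dist_compl dOE DE.
have zO : dclosure d [set y | z y != 0] `<=` Omega.
  move=> w hw; apply: contrapT => nOw.
  have [y /= /zgt zy wy] := hw m0 m00.
  by have := zm y zy; have := dOub y w nOw; rewrite (distC hd y w); lra.
have zT y : z y != 0 -> d x0 y <= 2 * r0.
  by move=> /zgt /psi_supp [_]; lra.
have T0 : 0 < 2 * r0 by lra.
have S0 y : 0 <= step_fun h0 U0 l h U y by exact: step_fun_ge0.
have mS : measurable_fun setT (step_fun h0 U0 l h U) by exact: measurable_step_fun.
have main := hardy_test_fun hd hB hcomp hfin hdoub oO hardy p1 bp z01 zlip m00 Dm Dlip g0 mg zloc
  a0 a1 r_0 n0 T0 zT zD zO (ltW k0) kCH S0 mS Hpt.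
have mE : measurable (nbhd_set d E r) by apply: (measurable_nbhd_set _ hd hB); exists x.
have mB := measurable_cball hd hB x Rb.
(* On [A] the cutoff is 1 and the distance at most [r]. The rest of the neighbourhood lies in the
   [U j]: its points outside [Omega] are within [r] of [E], hence in [F], hence covered. *)
pose A := (nbhd_set d E r `&` cball d x Rb `&` Omega) `&` [set y | forall j, j \in l -> ~ U j y].
have mA : measurable A.
  apply: measurableI; first by apply: measurableI => //; exact: measurableI.
  have -> : [set y | forall j, j \in l -> ~ U j y] = ~` (\big[setU/set0]_(j <- l) U j).
    rewrite -bigcup_seq; apply/seteqP; split => y /= hy.
      by move=> [j /= jl Uy]; exact: (hy j jl).
    by move=> j jl Uy; apply: hy; exists j.
  by apply: measurableC; exact: bigsetU_measurable.
have nearE y : nbhd_set d E r y -> exists2 e, E e & d y e < r.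
  by move=> /ereal_inf_lt [_ [e Ee <-]]; rewrite lte_fin => h'; exists e.
have cover : (mu (nbhd_set d E r `&` cball d x Rb) <= mu A + \sum_(j <- l) mu (U j))%E.
  apply: measure_cover_seq => //; first exact: measurableI.
  move=> y [Ey By]; have [[j jl Uy]|nU] := pselect (exists2 j, j \in l & U j y).
    by right; exists j.
  left; split; last by move=> j jl Uy; apply: nU; exists j.
  split => //; apply: contrapT => nOy; apply: nU.
  have [e [he _] ye] := nearE y Ey.
  have Fy : F y.
    split => //; rewrite /cball /=; have := dist_triangle hd e x0 y; rewrite (distC hd e y).
    by move: he; rewrite /cball /=; lra.
  have [j jl cj] := hcov y Fy; exists j => //; rewrite /U /=.
  by have := rk0 j jl; lra.
have lower : ((r `^ (- (q + de)))%:E * mu A <=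
    \int[mu]_(y in Omega) (test_fun z D a r n y `^ p * D y `^ (beta - p))%:E)%E.
  have -> : ((r `^ (- (q + de)))%:E * mu A =
      \int[mu]_(y in Omega) ((r `^ (- (q + de)))%:E * (\1_A y)%:E))%E.
    rewrite ge0_integralZl_EFin ?powR_ge0 //; last by apply/measurable_EFinP/measurable_funTS; exact: measurable_indic.
    rewrite integral_indic //; congr (_ * mu _)%E.
    by apply/esym/setIidPl => y [[]].
  apply: ge0_le_integral => //.
  - by move=> y _; rewrite -EFinM lee_fin mulr_ge0 ?powR_ge0 // indicE; case: (_ \in _).
  - apply: measurable_funTS; apply/measurable_EFinP; apply: measurable_funM => //; exact: measurable_indic.
  - apply/measurable_EFinP/measurable_funTS; apply: measurable_funM.
      apply: (measurableT_comp (measurable_powR _)).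
      exact: (measurable_test_fun hd hB _ z01 zlip m00 Dm Dlip a0 a1 r_0).
    apply: (measurableT_comp (measurable_powR _)).
    by apply: (measurable_lip hd hB); exists 1 => y w; rewrite mul1r.
  move=> y _; rewrite -EFinM lee_fin indicE; case: (boolP (y \in A)) => [|_]; last first.
    by rewrite mulr0 mulr_ge0 ?powR_ge0.
  rewrite inE => -[[[Ey By] _] nU]; rewrite mulr1.
  have [e [he nOe] ye] := nearE y Ey.
  have zy : z y = 1.
    rewrite zeq; last by move=> j jl; rewrite leNgt; apply/negP; exact: nU.
    apply: clamp_ge1; rewrite lerBrDr -lerBrDl (_ : 2 - 1 = 8 / Rb * (Rb / 8)); last first.
      by field; rewrite gt_eqF.
    rewrite ler_wpM2l ?divr_ge0 ?(ltW R0) // ge_max; apply/andP; split.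
      by move: By; rewrite /cball /=; lra.
    have := dist_triangle hd e x0 y; rewrite (distC hd e y).
    by move: he; rewrite /cball /=; lra.
  have Dr : D y <= r.
    by rewrite DE ?zy //; apply: le_trans (dOub y e nOe) _; exact: ltW.
  rewrite /test_fun zy expr1n mul1r -(opprB p).
  by apply: bump_weight_powR_ge => //; exact: ltW.
have upper : (\int[mu]_(y in Omega) (step_fun h0 U0 l h U y)%:E <=
   h0%:E * mu U0 + \sum_(j <- l) (h j)%:E * mu (U j))%E by exact: integral_step_fun.
have [b muB] : exists b, mu (cball d x Rb) = b%:E.
  by exists (fine (mu (cball d x Rb))); exact: cball_fineK.
have muU0 : (mu U0 <= (Cd * b)%:E)%E.
  apply: le_trans (_ : (mu (cball d x (2 * Rb)) <= _)%E).
    apply: mu_le => //; first exact: measurable_cball.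
    by move=> y; rewrite /U0 /cball /= => /ltW.
  by apply: le_trans (hdoub x R0) _; rewrite EFinM muB.
have muU j : j \in l -> (mu (U j) <= (Cd ^+ 2)%:E * mu (cball d (c j) (rk j)))%E.
  move=> jl; apply: le_trans (doubling_iter hfin hdoub _ 2 (rk0 j jl)).
  apply: mu_le => //; first exact: measurable_cball.
  by move=> y; rewrite /U /cball /= expr2 -natrM => /ltW.
set SS := (\sum_(j <- l) _)%E in hsum.
(* As the radii are at most 1 and [q - de] is positive, the weights in the content are at least 1,
   so the sum also controls the measures; [Cd ^+ 2] accounts for the radius [4 * rk j]. *)
have sumU : (\sum_(j <- l) mu (U j) <= (Cd ^+ 2 * tau)%:E)%E.
  apply: le_trans (_ : ((Cd ^+ 2)%:E * SS <= _)%E); last first.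
    by rewrite (EFinM (Cd ^+ 2)); apply: lee_wpmul2l; [rewrite lee_fin exprn_ge0 ?ltW|exact: ltW].
  rewrite /SS ge0_sume_distrr; last by move=> j _; rewrite mule_ge0 ?lee_fin ?powR_ge0.
  rewrite big_seq [leRHS]big_seq; apply: lee_sum => j jl.
  apply: le_trans (muU j jl) _; apply: lee_wpmul2l; first by rewrite lee_fin exprn_ge0 ?ltW.
  rewrite -[leLHS]mul1e; apply: lee_wpmul2r => //; rewrite lee_fin.
  rewrite -(powRr0 (rk j)); apply: ger_powR; first exact: hrk.
  by rewrite oppr_le0 ltW.
have sumhU : (\sum_(j <- l) (h j)%:E * mu (U j) <= (C2 r * Cd ^+ 2 * tau)%:E)%E.
  apply: le_trans (_ : ((C2 r * Cd ^+ 2)%:E * SS <= _)%E); last first.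
    by rewrite (EFinM (C2 r * Cd ^+ 2)); apply: lee_wpmul2l; [rewrite lee_fin mulr_ge0 ?exprn_ge0 ?(ltW Cd0)|exact: ltW].
  rewrite /SS ge0_sume_distrr; last by move=> j _; rewrite mule_ge0 ?lee_fin ?powR_ge0.
  rewrite big_seq [leRHS]big_seq; apply: lee_sum => j jl.
  apply: le_trans (lee_wpmul2l _ (muU j jl)) _; first by rewrite lee_fin.
  rewrite !muleA -!EFinM /h; apply: lee_wpmul2r => //.
  by rewrite lee_fin mulrAC.
have [al muA] : exists al, mu A = al%:E.
  exists (fine (mu A)); rewrite fineK // ge0_fin_numE //.
  apply: le_lt_trans (_ : (mu (cball d x Rb) < +oo)%E).
    by apply: mu_le => // y [[[]]].
  by have [] := hfin x R0.
move: cover lower; rewrite muB muA => cover lower.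
have fin : r `^ (- (q + de)) * al <= 2 * CH * (h0 * (Cd * b) + C2 r * Cd ^+ 2 * tau).
  rewrite -lee_fin EFinM; apply: le_trans lower _; apply: le_trans main _.
  rewrite (EFinM (2 * CH)); apply: lee_wpmul2l; first by rewrite lee_fin mulr_ge0 ?(ltW CH0).
  apply: le_trans upper _; rewrite EFinD (EFinM h0); apply: leeD => //.
  by apply: lee_wpmul2l; rewrite ?lee_fin.
apply: le_trans cover _; apply: le_trans (leeD2l _ sumU) _.
rewrite -EFinM -!EFinD lee_fin /hardy_codim_cst.
have rho0 : 0 < r `^ (q + de) by rewrite powR_gt0.
have fin' : al <= r `^ (q + de) * (2 * CH * (h0 * (Cd * b) + C2 r * Cd ^+ 2 * tau)).
  by move: fin; rewrite powRN mulrC ler_pdivrMr // mulrC.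
have e8 : r `^ (q + de) * (8 / Rb) `^ (q + de) = 8 `^ (q + de) * (r / Rb) `^ (q + de).
  rewrite -!powRM ?divr_ge0 ?(ltW r_0) ?(ltW R0) //.
  by congr (_ `^ _); ring.
have fin2 : r `^ (q + de) * (2 * CH * (h0 * (Cd * b) + C2 r * Cd ^+ 2 * tau)) =
  2 * CH * C1 * Cd * b * (r `^ (q + de) * (8 / Rb) `^ (q + de)) +
  r `^ (q + de) * (2 * CH * C2 r) * Cd ^+ 2 * tau by rewrite /h0; ring.
rewrite fin2 e8 in fin'.
apply: le_trans (lerD fin' (lexx _)) _.
by rewrite le_eqVlt; apply/orP; left; apply/eqP; ring.
Qed.

(** The previous estimate with [tau] tending to 0 while [r] and [Rb] stay fixed. *)
Lemma hardy_content_limit x0 r0 s x r Rb : 0 < r0 ->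
  q - de <= s -> haus_content d mu s 1 (cball d x0 (2 * r0) `&` ~` Omega) = 0%E ->
  (cball d x0 r0 `&` ~` Omega) x -> 0 < r -> r <= Rb / 8 -> Rb < 2 * r0 ->
  (mu (nbhd_set d (cball d x0 r0 `&` ~` Omega) r `&` cball d x Rb) <=
   (hardy_codim_cst * (r / Rb) `^ (q + de))%:E * mu (cball d x Rb))%E.
Proof.
move=> r00 qs cont0 Ex r_0 rR Rr0.
have R0 : 0 < Rb by lra.
have est tau := @hardy_content_estimate x0 r0 s x r Rb tau r00 qs cont0 Ex r_0 rR Rr0.
have [b muB] : exists b, mu (cball d x Rb) = b%:E.
  by exists (fine (mu (cball d x Rb))); exact: cball_fineK.
have mE : measurable (nbhd_set d (cball d x0 r0 `&` ~` Omega) r).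
  by apply: (measurable_nbhd_set _ hd hB); exists x.
move: est mE; set P := _ `&` cball d x Rb; set M := _ * Cd ^+ 2 => est mE.
have mP : measurable P by apply: measurableI => //; exact: measurable_cball.
have [w muP] : exists w, mu P = w%:E.
  exists (fine (mu P)); rewrite fineK // ge0_fin_numE //.
  apply: le_lt_trans (_ : (mu (cball d x Rb) < +oo)%E); last by rewrite muB ltry.
  by apply: mu_le => //; [exact: measurable_cball|exact: subIsetr].
rewrite muP muB -EFinM lee_fin; apply/ler_addgt0Pr => e e0.
have M1 : 0 < `|M| + 1 by have := normr_ge0 M; lra.
have := est (e / (`|M| + 1)) (divr_gt0 e0 M1).
rewrite muP muB -EFinM -EFinD lee_fin => /le_trans; apply.
rewrite lerD2l mulrCA ler_piMr ?(ltW e0) // ler_pdivrMr // mul1r.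
by have := ler_norm M; lra.
Qed.

End KeyEstimate.

(** * The dichotomy *)

(** The order of choice matters: [a] comes from [p], [beta] and [CH], then [n] is taken large in
    terms of [a], and [k] small in terms of [n]. *)
Lemma exists_parameters (R : realType) (p beta CH : R) : 1 <= p -> beta < p -> 0 < CH ->
  exists (a k : R) (n : nat), [/\ 0 < a < 1, 0 < k <= 1, (0 < n)%N & 
    [/\ (4 * (n.+1%:R * k + a)) `^ p * CH <= 2^-1, a * p < p - beta & `|beta| + a * p <= n%:R]].
Proof.
move=> p1 bp CH0.
have p0 : 0 < p by lra.
(* Since [t <= 1 <= p], t^p is at most t, so t^p times [CH] is at most 1/2. With [a] and
   [n.+1%:R * k] at most [t / 8], the base in the claim is at most [t]. *)
pose t := Num.min 1 (2 * CH)^-1.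
have t0 : 0 < t by rewrite lt_min ltr01 invr_gt0 mulr_gt0.
have t1 : t <= 1 by rewrite ge_min lexx.
have tCH : t `^ p * CH <= 2^-1.
  apply: le_trans (_ : t * CH <= _).
    by rewrite ler_pM2r // ge1r_powR // t0 t1.
  rewrite -ler_pdivlMr // -invfM ge_min; apply/orP; right.
  by rewrite lexx.
pose a := Num.min (t / 8) ((p - beta) / (2 * p)).
have a0 : 0 < a by rewrite lt_min !divr_gt0 ?mulr_gt0 ?subr_gt0.
have at8 : a <= t / 8 by rewrite ge_min lexx.
have apq : a * p < p - beta.
  apply: le_lt_trans (_ : (p - beta) / (2 * p) * p < _).
    by rewrite ler_pM2r // ge_min lexx orbT.
  have -> : (p - beta) / (2 * p) * p = (p - beta) / 2 by field; rewrite gt_eqF.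
  lra.
pose n := (Num.truncn (`|beta| + a * p)).+1.
pose k := t / 8 / n.+1%:R.
have n1 : 1 <= n.+1%:R :> R by rewrite ler1n.
have n0 : 0 < n.+1%:R :> R by lra.
exists a, k, n; split.
- by rewrite a0 /=; lra.
- rewrite /k divr_gt0 //= ?divr_gt0 // ler_pdivrMr //; lra.
- by [].
split => //; last exact/ltW/truncnS_gt.
apply: le_trans tCH; rewrite ler_pM2r //; apply: ge0_ler_powR; rewrite ?nnegrE ?(ltW p0) ?(ltW t0) //.
  by rewrite mulr_ge0 // addr_ge0 ?(ltW a0) // mulr_ge0 ?ler0n // !divr_ge0 ?ler0n ?(ltW t0).
have -> : n.+1%:R * k = t / 8 by rewrite /k; field; rewrite gt_eqF.
lra.
Qed.

Section Codimension.
Context {R : realType} {dX : measure_display} {X : measurableType dX}.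
Variables (d : X -> X -> R) (mu : {measure set X -> \bar R}).
Hypotheses (hd : is_metric d) (hB : borel_sigma d).

Lemma lower_codim_A_ge0 (E : set X) : (0 <= lower_codim_A d mu E)%E.
Proof.
apply: ereal_sup_ubound; exists 0 => //; split => //; exists 1; split => // x r Rb Ex r0 rR _.
rewrite powRr0 mulr1 mul1e; apply: mu_le; [|exact: measurable_cball|exact: subIsetr].
apply: measurableI; last exact: measurable_cball.
by apply: (measurable_nbhd_set _ hd hB); exists x.
Qed.

(* For [Rb / 8 < r < Rb] the trivial bound by the measure of the whole ball
   costs only the factor [8 `^ t]. *)
Lemma lower_codim_A_ge (E : set X) (t K : R) : 0 <= t ->
  (forall x r Rb, E x -> 0 < r -> r <= Rb / 8 -> (Rb%:E < ediam d E)%E ->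
    (mu (nbhd_set d E r `&` cball d x Rb) <= (K * (r / Rb) `^ t)%:E * mu (cball d x Rb))%E) ->
  (t%:E <= lower_codim_A d mu E)%E.
Proof.
move=> t0 hK; apply: ereal_sup_ubound; exists t => //; split => //.
have e8 : 1 <= 8 `^ t :> R.
  by rewrite -[leLHS](powRr0 8) ler_powR //; lra.
exists (Num.max K (8 `^ t)); split; first by rewrite le_max e8 orbT.
move=> x r Rb Ex r0 rR hR.
have R0 : 0 < Rb by lra.
case: (leP r (Rb / 8)) => r8.
  apply: le_trans (hK x r Rb Ex r0 r8 hR) _; apply: lee_wpmul2r => //.
  by rewrite lee_fin ler_wpM2r ?powR_ge0 // le_max lexx.
apply: le_trans (_ : (1 * mu (cball d x Rb) <= _)%E).
  rewrite mul1e; apply: mu_le; [|exact: measurable_cball|exact: subIsetr].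
  apply: measurableI; last exact: measurable_cball.
  by apply: (measurable_nbhd_set _ hd hB); exists x.
apply: lee_wpmul2r => //; rewrite lee_fin.
apply: le_trans (_ : 8 `^ t * (r / Rb) `^ t <= _); last first.
  by rewrite ler_wpM2r ?powR_ge0 // le_max lexx orbT.
rewrite -powRM ?divr_ge0 ?(ltW r0) ?(ltW R0) //.
rewrite -[leLHS](powRr0 (8 * (r / Rb))) ler_powR //.
by rewrite mulrA ler_pdivlMr //; lra.
Qed.

(** Positivity of [u] excludes the branch of positive measure, where the codimension is 0; then [t]
    lies strictly below the supremum of the admissible exponents. *)
Lemma codim_H_content (F : set X) (t u : R) : 0 < u -> t < u ->
  (u%:E <= codim_H d mu F)%E -> exists2 s, t <= s & haus_content d mu s 1 F = 0%E.
Proof.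
move=> u0 tu; rewrite /codim_H; case: ifP => _.
  by rewrite lee_fin leNgt u0.
move=> uF; have /ereal_sup_gt [_ [s [s0 hs] <-]] : (t%:E < ereal_sup [set q%:E | q in [set q : R | (0 <= q)%R /\ haus_content d mu q 1 F = 0%E]])%E.
  by apply: lt_le_trans uF; rewrite lte_fin.
by rewrite lte_fin => /ltW ts; exists s.
Qed.

Lemma ediam_lt_ball (x0 : X) (r0 Rb : R) (E : set X) : E `<=` cball d x0 r0 ->
  (Rb%:E < ediam d E)%E -> Rb < 2 * r0.
Proof.
move=> EB /ereal_sup_gt [_ [y [z [/EB Ey [/EB Ez ->]]]]].
move: Ey Ez; rewrite /cball /= lte_fin => Ey Ez.
by have := dist_triangle hd x0 y z; rewrite (distC hd y x0); lra.
Qed.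

End Codimension.

Theorem theorem6p2 (R : realType) (p beta Cd CH : R) :
  1 <= p -> beta != p ->
  exists eps : R, 0 < eps /\
    forall (dX : measure_display) (X : measurableType dX) (d : X -> X -> R)
      (mu : {measure set X -> \bar R}) (Omega : set X),
      is_metric d -> dcomplete d -> borel_sigma d ->
      balls_pos_finite d mu -> doubling_with d mu Cd ->
      dopen d Omega -> hardy_ineq d mu Omega p beta CH ->
      forall (x0 : X) (r0 : R), 0 < r0 ->
        (codim_H d mu (cball d x0 (2 * r0) `&` ~` Omega) < (p - beta - eps)%:E)%E
        \/ ((p - beta + eps)%:E < lower_codim_A d mu (cball d x0 r0 `&` ~` Omega))%E.
Proof.
move=> p1; rewrite neq_lt => /orP[bp|pb]; last first.
  (* With this value p - beta + eps is negative, below every lower Assouad codimension. *)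
  exists ((beta - p) / 2); split; first by lra.
  move=> dX X d mu Omega hd _ hB _ _ _ _ x0 r0 _; right.
  by apply: lt_le_trans (lower_codim_A_ge0 mu hd hB _); rewrite lte_fin; lra.
have [CH0|CH0] := ltP 0 CH; last first.
  exists 1; split => // dX X d mu Omega _ _ _ _ _ _ [CH0'].
  by move: CH0; rewrite leNgt CH0'.
have [a [k [n [/andP[a0 a1] /andP[k0 k1] n0 [kCH apq bn]]]]] := exists_parameters p1 bp CH0.
have ap0 : 0 < a * p by rewrite mulr_gt0 //; lra.
(* Half of [a * p] leaves room on both sides: codimension at least p - beta - eps yields an exponent
   of zero content that is at least p - beta - a p, and the exponent p - beta + a p obtained at the
   end strictly exceeds p - beta + eps. The value is fixed before the space is given. *)
exists (a * p / 2); split; first by lra.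
move=> dX X d mu Omega hd hcomp hB hfin hdoub oO hardy x0 r0 r00.
have [|hF] := ltP; first by left.
right; have [||s qs cont0] := @codim_H_content _ _ _ d mu _ (p - beta - a * p) _ _ _ hF; [lra|lra|].
apply: lt_le_trans (_ : (p - beta + a * p)%:E <= _)%E; first by rewrite lte_fin; lra.
apply: (@lower_codim_A_ge _ _ _ d mu hd hB _ _ (hardy_codim_cst Cd p beta CH a k n)); first by lra.
move=> x r Rb Ex r_0 r8 hR.
have Rr := ediam_lt_ball hd (@subIsetl _ _ _) hR.
exact: (hardy_content_limit hd hB hcomp hfin hdoub oO hardy p1 bp a0 a1 k0 k1 n0 kCH apq bn r00 qs cont0 Ex r_0 r8 Rr).
Qed.
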